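(* Let $X$ be a Banach space with property $(\mathfrak{su})$ and let $C\in\mathcal{B}(X)$. Then either $C$ is weakly compact, or $C$ contains an $\ell_1$-sequence, or $C$ contains a uniformly shift equivalent wide-$(s)$ sequence.
   Context: $\mathcal{B}(X)$ denotes the family of all nonempty bounded, closed, convex subsets of $X$. Two sequences $(x_n)$, $(y_n)$ in Banach spaces are $L$-equivalent, written $(x_n)\sim_L(y_n)$, if $\frac1L\|\sum a_ix_i\|\le\|\sum a_iy_i\|\le L\|\sum a_ix_i\|$ for all finitely supported scalar sequences $(a_i)$; they are equivalent if they are $L$-equivalent for some $L\ge1$. An $\ell_1$-sequence is a sequence equivalent to the standard unit vector basis of $\ell_1$. A sequence $(w_n)$ is uniformly $L$-shift equivalent if $(w_{n+p})_n\sim_L(w_n)_n$ for every $p\in\mathbb{N}$, and uniformly shift equivalent if this holds for some $L$. A basic sequence is a sequence which is a Schauder basis of its closed linear span. A sequence $(x_n)$ is seminormalized if $0<\inf_n\|x_n\|\le\sup_n\|x_n\|<\infty$. A wide-$(s)$ sequence is a seminormalized basic sequence $(x_n)$ which dominates the summing basis $s_n=e_1+\dots+e_n$ of $c_0$ ($(e_n)$ the canonical basis, sup norm), i.e. there is $D>0$ with $\|\sum a_ns_n\|_\infty\le D\|\sum a_nx_n\|$ for all finitely supported $(a_n)$. A weak Cauchy sequence is non-trivial if it is not weakly convergent. A convex block sequence of $(x_n)$ is a sequence of the form $\big(\sum_{i\in F_n}\lambda_i^n x_i\big)_n$, where $(F_n)$ are nonempty finite subsets of $\mathbb{N}$ with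 $\max F_n<\min F_{n+1}$ for all $n$, $\lambda^n_i\in[0,1]$, and $\sum_{i\in F_n}\lambda_i^n=1$. A basic sequence $(x_n)$ is convex block shiftable if there exist $L>0$ and a subsequence $(y_n)$ of $(x_n)$ such that every convex block sequence of $(y_n)$ is uniformly $L$-shift equivalent. A Banach space $X$ has property $(\mathfrak{su})$ if for every non-trivial weak Cauchy sequence $(x_n)$ in $X$ there exists a convex block shiftable sequence $(w_n)$ in $X$ such that $(x_n-w_n)$ is weakly null. *)

(* Defs.v *)
From HB Require Import structures.
From mathcomp Require Import all_boot all_order all_algebra finmap.
From mathcomp Require Import all_classical all_reals all_analysis.

Set Implicit Arguments.
Unset Strict Implicit.
Unset Printing Implicit Defensive.

Import Order.TTheory GRing.Theory Num.Theory.
Import numFieldNormedType.Exports.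

Local Open Scope classical_set_scope.
Local Open Scope ring_scope.

Section SequencesUpToEquivalence.
Context {R : realType}.

(* A finitely supported scalar sequence is represented by an arbitrary
   [a : nat -> R] together with a cut-off [N]. *)
Definition lin_comb {V : lmodType R} (x : nat -> V) (a : nat -> R) (N : nat)
    : V :=
  \sum_(i < N) a i *: x i.

(* The norms are explicit arguments, so that the definitions below apply to a
   normed space as well as to the concrete sequence spaces l1 and c0, whose
   elements are represented as functions [nat -> R^o]. *)
Definition L_equivalent_for {V W : lmodType R} (nV : V -> R) (nW : W -> R)
    (L : R) (x : nat -> V) (y : nat -> W) :=
  forall (a : nat -> R) (N : nat),
    L^-1 * nV (lin_comb x a N) <= nW (lin_comb y a N) /\
    nW (lin_comb y a N) <= L * nV (lin_comb x a N).

Definition equivalent_for {V W : lmodType R} (nV : V -> R) (nW : W -> R)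
    (x : nat -> V) (y : nat -> W) :=
  exists2 L : R, 1 <= L & L_equivalent_for nV nW L x y.

Definition dominates_for {V W : lmodType R} (nV : V -> R) (nW : W -> R)
    (x : nat -> V) (y : nat -> W) :=
  exists2 D : R, 0 < D &
    forall (a : nat -> R) (N : nat),
      nW (lin_comb y a N) <= D * nV (lin_comb x a N).

(* Total functions, meaningful on l1 and on bounded sequences respectively;
   they are only ever applied to finitely supported sequences. *)
Definition l1_norm (u : nat -> R^o) : R := limn (series (fun i => `|u i| : R)).
Definition sup_norm (u : nat -> R^o) : R := sup (range (fun i => `|u i|)).

Definition unit_vector (n : nat) : nat -> R^o := fun i => (i == n)%:R.

Definition summing_basis (n : nat) : nat -> R^o :=
  \sum_(k < n.+1) unit_vector k.

End SequencesUpToEquivalence.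

Section WeakTopology.
Context {R : realType}.

Definition dual (X : normedModType R) : Type :=
  {f : {linear X -> R^o} | continuous f}.

(* The coarsest topology on X making all elements of the dual continuous. *)
Definition weak_topology (X : normedModType R) : topologicalType :=
  sup_topology (fun f : dual X =>
    Topological.class (initial_topology (sval f : X -> R^o))).

Definition weakly_compact {X : normedModType R} (C : set X) :=
  compact (C : set (weak_topology X)).

Definition weakly_converges {X : normedModType R} (x : nat -> X) (l : X) :=
  x @ \oo --> (l : weak_topology X).

Definition weakly_null {X : normedModType R} (x : nat -> X) :=
  weakly_converges x 0.

Definition weak_cauchy {X : normedModType R} (x : nat -> X) :=
  forall f : dual X, cauchy (sval f (x n) @[n --> \oo]).

Definition nontrivial_weak_cauchy {X : normedModType R} (x : nat -> X) :=
  weak_cauchy x /\ ~ exists l : X, weakly_converges x l.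

End WeakTopology.

Section BasicSequences.
Context {R : realType} {X : normedModType R}.
Implicit Types x y w : nat -> X.

Definition linear_span x : set X :=
  [set v | exists a N, v = lin_comb x a N].

Definition schauder_basis x (V : set X) :=
  (forall n, V (x n)) /\
  forall v, V v ->
    exists! a : nat -> R, series (fun i => a i *: x i) @ \oo --> v.

Definition basic_sequence x := schauder_basis x (closure (linear_span x)).

Definition seminormalized x :=
  0 < inf (range (fun n => `|x n|)) /\ has_ubound (range (fun n => `|x n|)).

Definition l1_sequence x :=
  equivalent_for Num.norm l1_norm x unit_vector.

Definition wide_s x :=
  [/\ seminormalized x, basic_sequence x &
      dominates_for Num.norm sup_norm x summing_basis].

Definition uniformly_L_shift_equivalent (L : R) w :=
  forall p : nat,
    L_equivalent_for Num.norm Num.norm L (fun n => w (n + p)%N) w.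

Definition uniformly_shift_equivalent w :=
  exists2 L : R, 1 <= L & uniformly_L_shift_equivalent L w.

Definition convex_block_of x y :=
  exists (F : nat -> {fset nat}) (lambda : nat -> nat -> R),
    [/\ forall n, F n != fset0,
        forall n i j, i \in F n -> j \in F n.+1 -> (i < j)%N,
        forall n i, i \in F n -> 0 <= lambda n i <= 1,
        forall n, \sum_(i <- F n) lambda n i = 1 &
        forall n, y n = \sum_(i <- F n) lambda n i *: x i].

Definition convex_block_shiftable x :=
  basic_sequence x /\
  exists (L : R) (phi : nat -> nat),
    [/\ 0 < L, increasing_seq phi &
        forall y, convex_block_of (x \o phi) y ->
          uniformly_L_shift_equivalent L y].

End BasicSequences.

Definition property_su {R : realType} (X : normedModType R) :=
  forall x : nat -> X, nontrivial_weak_cauchy x ->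
    exists w : nat -> X,
      convex_block_shiftable w /\ weakly_null (fun n => x n - w n).

Definition bounded_closed_convex {R : realType} {X : normedModType R}
    (C : set X) :=
  [/\ C !=set0, bounded_set C, closed C &
      convex_set (C : set (convex_lmodType X))].

(* Main.v *)
From HB Require Import structures.
Require Import Defs.
From mathcomp Require Import finmap all_boot all_order all_algebra.
From mathcomp Require Import all_classical all_reals all_analysis.
From mathcomp Require Import ring lra.

(** Suppose that C is not weakly compact. By the Eberlein-Smulian theorem
    ([eberlein_smulian]) some sequence of C has no weakly convergent
    subsequence, and by Rosenthal's theorem ([rosenthal_l1]) it has a
    subsequence which is either an l1-sequence or weak Cauchy. In the second
    case call it x, and let phi be its limit along the functionals: an element
    of the bidual which, X being complete, has a distance e > 0 to X
    ([weak_limit_gap]).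

    Property (su) provides w, with x - w weakly null, and a subsequence of w all
    of whose convex block sequences are uniformly L-shift equivalent. By Mazur's
    lemma successive convex combinations of x - w along this subsequence can be
    made as small as desired ([null_blocks]); they yield convex blocks u of x,
    which lie in C, and convex blocks v of w, with u - v small. It remains to
    see that v is well behaved, with constants known before the blocks are
    chosen.

    The key point is that v dominates each sequence v_0, .., v_(m-1), v_(m+q),
    v_(m+q+1), .. obtained by delaying its tail, with the constant L ^ 2
    ([delay_bound]): this is again a convex block sequence, and it has a shift
    in common with v. When q tends to infinity, sum_(i < N) a_i v_i turns into
    the bidual element sum_(i < m) a_i v_i + (sum_(m <= i < N) a_i) phi. As phi
    is at distance e from X, its norm controls the tail sum of the a_i
    ([tail_sum_bound]), so that v dominates the summing basis, and then also the
    norm of the partial sum ([partial_sum_bound]), so that v is basic. Both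
    estimates, and the shift equivalence, pass to the small perturbation u
    of v. *)

Set Implicit Arguments.
Unset Strict Implicit.
Unset Printing Implicit Defensive.

Import Order.TTheory GRing.Theory Num.Theory.
Import numFieldNormedType.Exports.

Local Open Scope classical_set_scope.
Local Open Scope ring_scope.

(** * The Hahn-Banach theorem *)

Section HahnBanach.
Context {R : realType} {V : lmodType R}.
Implicit Types p q : V -> R.

Definition sublinear q :=
  (forall x y, q (x + y) <= q x + q y) /\
  (forall t x, 0 <= t -> q (t *: x) = t * q x).

Lemma sublinear0 q : sublinear q -> q 0 = 0.
Proof. by move=> [_ qZ]; rewrite -(scale0r 0) qZ// mul0r. Qed.

Lemma sublinear_lb q x : sublinear q -> - q (- x) <= q x.
Proof.
move=> sq; have := sq.1 x (- x).
by rewrite subrr (sublinear0 sq); lra.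
Qed.

(** Replacing t by its inverse turns one inequality of positive homogeneity
    into the other. *)
Lemma sublinearP q : (forall x y, q (x + y) <= q x + q y) -> q 0 = 0 ->
  (forall t x, 0 < t -> t * q x <= q (t *: x)) -> sublinear q.
Proof.
move=> qD q0 key; split=> // t x; rewrite le_eqVlt => /predU1P[<-|t0].
  by rewrite scale0r mul0r.
apply/eqP; rewrite eq_le key// andbT.
have := key t^-1 (t *: x); rewrite invr_gt0 => /(_ t0).
by rewrite scalerA mulVf ?gt_eqF// scale1r ler_pdivrMl.
Qed.

(** Take q' x = inf_(t >= 0) (q (x + t y) - t q y): the two bounds come from
    t = 0 and t = 1. *)
Lemma sublinear_descent q y : sublinear q ->
  exists q', [/\ sublinear q', forall x, q' x <= q x &
    forall x, q' x + q y <= q (x + y)].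
Proof.
move=> sq; have [qD qZ] := sq.
pose S x := [set q (x + t *: y) - t * q y | t in [set t : R | 0 <= t]].
have S0 x : S x !=set0 by exists (q (x + 0 *: y) - 0 * q y); exists 0 => //=.
have Slb x : lbound (S x) (- q (- x)).
  move=> _ [t /= t0 <-]; rewrite -qZ//.
  have := qD (x + t *: y) (- x); rewrite addrAC subrr add0r; lra.
have Sl x : has_lbound (S x) by exists (- q (- x)).
have infle x t : 0 <= t -> inf (S x) <= q (x + t *: y) - t * q y.
  by move=> t0; apply: ge_inf => //; exists t.
exists (fun x => inf (S x)); split; first apply: sublinearP.
- move=> x z; rewrite -lerBlDr; apply: lb_le_inf => // _ [t /= t0 <-].
  rewrite lerBlDr -lerBlDl; apply: lb_le_inf => // _ [s /= s0 <-].
  rewrite lerBlDl.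
  apply: (le_trans (infle _ _ (addr_ge0 t0 s0))).
  have := qD (x + t *: y) (z + s *: y).
  by rewrite addrACA -scalerDl; lra.
- apply/eqP; rewrite eq_le; apply/andP; split.
    have := infle 0 0 (lexx 0).
    by rewrite scale0r addr0 mul0r subr0 (sublinear0 sq).
  apply: lb_le_inf => // z Sz; apply: le_trans (Slb 0 _ Sz).
  by rewrite oppr0 (sublinear0 sq) oppr0.
- move=> u z u0; apply: lb_le_inf => // _ [s /= s0 <-].
  have us0 : 0 <= u^-1 * s by rewrite mulr_ge0// invr_ge0 ltW.
  have := infle z _ us0; rewrite -(ler_pM2l u0) => /le_trans; apply.
  rewrite mulrBr -(qZ u) ?(ltW u0)//.
  by rewrite scalerDr scalerA !mulrA divff ?gt_eqF// !mul1r.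
- by move=> x; have := infle x 0 (lexx 0); rewrite scale0r addr0 mul0r subr0.
- move=> x; have := infle x 1 ler01; rewrite scale1r; lra.
Qed.

(** A minimal sublinear functional below q is linear: [sublinear_descent] cannot
    decrease it, which forces additivity. Minimal ones exist by Zorn's lemma,
    the pointwise infimum of a chain being finite because every sublinear
    p <= q satisfies p x >= - q (- x). *)
Lemma hahn_banach q : sublinear q ->
  exists f : {linear V -> R^o}, forall x, f x <= q x.
Proof.
move=> sq.
pose P p := sublinear p /\ forall x, p x <= q x.
pose T := {p : V -> R | P p}.
pose below (p p' : T) := `[< forall x, sval p' x <= sval p x >].
have [||r s rs sr|A Atot|p pmin] := @Zorn T below.
- by move=> t; apply/asboolP.
- move=> r s t /asboolP rs /asboolP st; apply/asboolP => x.
  exact: le_trans (st x) (rs x).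
- move: r s rs sr => [r Pr] [s Ps] /asboolP/= rs /asboolP/= sr.
  by apply: eq_exist; apply/funext => x; apply/eqP; rewrite eq_le rs sr.
- have [[p0 Ap0]|A0] := pselect (A !=set0); last first.
    exists (exist P q (conj sq (fun x => lexx _))) => s As.
    by exfalso; apply: A0; exists s.
  pose S x := [set sval (p : T) x | p in A].
  have S0 x : S x !=set0 by exists (sval p0 x), p0.
  have Slb x : lbound (S x) (- q (- x)).
    move=> _ [[p [/= sp pq]] _ <-]; apply: le_trans (sublinear_lb x sp).
    by rewrite lerN2.
  have Sl x : has_lbound (S x) by exists (- q (- x)).
  have infle x (p : T) : A p -> inf (S x) <= sval p x.
    by move=> Ap; apply: ge_inf => //; exists p.
  have sm : sublinear (fun x => inf (S x)).
    apply: sublinearP => [x z||u z u0].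
    - rewrite -lerBlDr; apply: lb_le_inf => // _ [p Ap <-].
      rewrite lerBlDr -lerBlDl; apply: lb_le_inf => // _ [p' Ap' <-].
      rewrite lerBlDl.
      have [/asboolP pp'|/asboolP p'p] := Atot _ _ Ap Ap'.
        apply: le_trans (infle _ _ Ap') _.
        by apply: le_trans ((svalP p').1.1 _ _) _; rewrite lerD2r.
      apply: le_trans (infle _ _ Ap) _.
      by apply: le_trans ((svalP p).1.1 _ _) _; rewrite lerD2l.
    - rewrite (_ : S 0 = [set 0]) ?inf1//.
      apply/seteqP; split=> [_ [p _ <-]|_ ->]; last first.
        by exists p0 => //; rewrite (sublinear0 (svalP p0).1).
      by rewrite (sublinear0 (svalP p).1).
    - apply: lb_le_inf => // _ [p Ap <-].
      by rewrite ((svalP p).1.2 u) ?(ltW u0)// ler_pM2l// infle.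
  have mq x : inf (S x) <= q x.
    exact: le_trans (infle _ _ Ap0) ((svalP p0).2 x).
  exists (exist P (fun x => inf (S x)) (conj sm mq)) => p Ap.
  by apply/asboolP => x /=; exact: infle.
- have [[pD pZ] pq] := svalP p.
  have padd x y : sval p (x + y) = sval p x + sval p y.
    have [q' [sq' q'p q'D]] := sublinear_descent y (svalP p).1.
    have q'q z : q' z <= q z by exact: le_trans (q'p z) (pq z).
    have /(congr1 sval)/= pq' := pmin (exist P q' (conj sq' q'q)) (asboolT q'p).
    by have := q'D x; rewrite pq' => pge; apply/eqP; rewrite eq_le pge pD.
  have pN x : sval p (- x) = - sval p x.
    apply/eqP; rewrite -subr_eq0 opprK -padd addNr.
    by rewrite (sublinear0 (svalP p).1).
  have plin : linear (sval p : V -> R^o).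
    move=> t x y; rewrite padd; congr (_ + _).
    have [t0|/ltW t0] := leP 0 t; first exact: pZ.
    by rewrite -[t]opprK scaleNr pN pZ ?oppr_ge0// -mulNr.
  pose lin := GRing.isLinear.Build R V R^o _ (sval p) plin.
  by exists (HB.pack_for {linear V -> R^o} (sval p : V -> R^o) lin).
Qed.

End HahnBanach.

(** * Functionals and separation of convex sets *)

Section Duality.
Context {R : realType}.
Implicit Types X : normedModType R.

(** Evaluation with values in R itself, so that the operations on values are
    those of R and not of the module R^o. *)
Definition dual_eval X (f : dual X) (x : X) : R := sval f x.
Coercion dual_eval : dual >-> Funclass.

Definition dual_ball X (f : dual X) := forall x, f x <= `|x|.

Lemma linear_bounded_dual X (p : {linear X -> R^o}) (M : R) :
  (forall x, `|p x| <= M * `|x|) -> exists f : dual X, forall x, f x = p x.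
Proof.
move=> pM; suff pc : continuous p by exists (exist _ p pc).
apply: bounded_linear_continuous.
apply/linear_boundedP; near=> r => x.
by apply: le_trans (pM x) _; rewrite ler_wpM2r//; near: r;
  exact: nbhs_pinfty_ge.
Unshelve. all: by end_near. Qed.

Lemma dualB X (f : dual X) x y : f (x - y) = f x - f y.
Proof. exact: linearB. Qed.

Lemma dual0 X (f : dual X) : f 0 = 0.
Proof. exact: linear0. Qed.

Lemma dualN X (f : dual X) x : f (- x) = - f x.
Proof. exact: linearN. Qed.

Lemma dualD X (f : dual X) x y : f (x + y) = f x + f y.
Proof. exact: linearD. Qed.

Lemma dualZ X (f : dual X) (c : R) x : f (c *: x) = c * f x.
Proof. exact: linearZ. Qed.

Lemma dual_lin_comb X (f : dual X) x a N :
  f (lin_comb x a N) = \sum_(i < N) a i * f (x i).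
Proof.
rewrite /lin_comb /dual_eval linear_sum; apply: eq_bigr => i _.
by rewrite linearZ.
Qed.

Lemma dual_bounded X (f : dual X) :
  exists2 M : R, 0 < M & forall x, `|f x| <= M * `|x|.
Proof.
have /linear_boundedP := @continuous_linear_bounded _ _ _ 0 _ (svalP f 0).
by move=> /pinfty_ex_gt0[M M0 fM]; exists M.
Qed.

Lemma dual_scale X (c : R) (f : dual X) :
  exists g : dual X, forall x, g x = c * f x.
Proof.
have [M M0 fM] := dual_bounded f.
have lin : linear (fun x => c * f x : R^o).
  by move=> t x y; rewrite dualD dualZ mulrDr; congr (_ + _); rewrite mulrCA.
pose l := GRing.isLinear.Build R X R^o _ _ lin.
pose p := HB.pack_for {linear X -> R^o} (fun x => c * f x : R^o) l.
apply: (@linear_bounded_dual _ p (`|c| * M)) => x.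
by rewrite /= normrM -mulrA ler_wpM2l.
Qed.

Lemma dual_ball_norm X (f : dual X) : dual_ball f -> forall x, `|f x| <= `|x|.
Proof.
by move=> fB x; rewrite ler_norml fB andbT lerNl -dualN -normrN fB.
Qed.

Lemma dual_ball_opp X (f : dual X) : dual_ball f ->
  exists2 g : dual X, dual_ball g & forall x, g x = - f x.
Proof.
move=> fB; have [g gE] := dual_scale (-1) f.
by exists g => x; rewrite gE mulN1r// -dualN -normrN; exact: fB.
Qed.

Lemma dual_normalize X (f : dual X) :
  exists2 M : R, 0 < M & exists2 g : dual X, dual_ball g &
    forall x, f x = M * g x.
Proof.
have [M M0 fM] := dual_bounded f; have [g gE] := dual_scale M^-1 f.
exists M => //; exists g => x; rewrite gE; last by rewrite mulVKf ?gt_eqF.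
rewrite ler_pdivrMl//; exact: le_trans (ler_norm _) (fM x).
Qed.

Definition convex_subset X (K : set X) := forall (t : R) x y,
  0 <= t -> t <= 1 -> K x -> K y -> K (t *: x + (1 - t) *: y).

Lemma convex_cone X (K : set X) (t s : R) k k' : convex_subset K ->
  0 <= t -> 0 <= s -> K k -> K k' ->
  exists2 k2, K k2 & t *: k + s *: k' = (t + s) *: k2.
Proof.
move=> Kc t0 s0 Kk Kk'; have [ts|ts] := eqVneq (t + s) 0.
  have [-> ->] : t = 0 /\ s = 0 by lra.
  by exists k => //; rewrite addr0 !scale0r addr0.
have ts0 : 0 < t + s by rewrite lt_neqAle eq_sym ts addr_ge0.
exists ((t / (t + s)) *: k + (1 - t / (t + s)) *: k').
  by apply: Kc => //; rewrite ?divr_ge0 ?(ltW ts0)// ler_pdivrMr// mul1r lerDl.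
rewrite scalerDr !scalerA mulrBr mulr1 mulrCA divff// mulr1.
by congr (_ + _ *: _); rewrite addrAC subrr add0r.
Qed.

Lemma convex_set_subset (X : normedModType R) (C : set X) :
  convex_set (C : set (convex_lmodType X)) -> convex_subset C.
Proof.
move=> Cc t x y t0 t1 Cx Cy.
have := Cc x y (Itv01 t0 t1) (mem_set Cx) (mem_set Cy).
by rewrite inE.
Qed.

(** The gauge q x = inf_(t >= 0, k in K) (|x + t k| - t e) is sublinear because
    the cone over K is convex, it is at most the norm (take t = 0), and
    q (- k) <= - e for k in K (take t = 1): any linear functional below q
    separates K from the origin. *)
Lemma convex_separation X (K : set X) (e : R) :
  K !=set0 -> convex_subset K -> (forall k, K k -> e <= `|k|) ->
  exists2 f : dual X, dual_ball f & forall k, K k -> e <= f k.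
Proof.
move=> [k0 Kk0] Kc Ke.
pose S x := [set u | exists t k, [/\ 0 <= t, K k & u = `|x + t *: k| - t * e]].
have S0 x : S x !=set0 by exists (`|x + 0 *: k0| - 0 * e), 0, k0.
have Slb x : lbound (S x) (- `|x|).
  move=> _ [t [k [t0 Kk ->]]].
  have tk : t * e <= `|t *: k| by rewrite normrZ ger0_norm// ler_wpM2l// Ke.
  have : `|t *: k| <= `|x + t *: k| + `|x|.
    by rewrite -{1}(addKr x (t *: k)) addrC -(normrN x); exact: ler_normD.
  lra.
have Sl x : has_lbound (S x) by exists (- `|x|).
have infle x t k : 0 <= t -> K k -> inf (S x) <= `|x + t *: k| - t * e.
  by move=> t0 Kk; apply: ge_inf => //; exists t, k.
have sq : sublinear (fun x => inf (S x)).
  apply: sublinearP => [x y||u x u0].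
  - rewrite -lerBlDr; apply: lb_le_inf => // _ [t [k [t0 Kk ->]]].
    rewrite lerBlDr -lerBlDl; apply: lb_le_inf => // _ [s [k' [s0 Kk' ->]]].
    have [k2 Kk2 kE] := convex_cone Kc t0 s0 Kk Kk'.
    rewrite lerBlDl; apply: le_trans (infle _ _ _ (addr_ge0 t0 s0) Kk2) _.
    rewrite -kE addrACA; have := ler_normD (x + t *: k) (y + s *: k'); lra.
  - apply/eqP; rewrite eq_le; apply/andP; split.
      have := infle 0 0 _ (lexx 0) Kk0.
      by rewrite scale0r addr0 normr0 mul0r subr0.
    apply: lb_le_inf => // z Sz; apply: le_trans (Slb 0 _ Sz).
    by rewrite normr0 oppr0.
  - apply: lb_le_inf => // _ [s [k [s0 Kk ->]]].
    have us0 : 0 <= u^-1 * s by rewrite mulr_ge0// invr_ge0 ltW.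
    have := infle x _ _ us0 Kk; rewrite -(ler_pM2l u0) => /le_trans; apply.
    rewrite mulrBr -{1}(gtr0_norm u0) -normrZ scalerDr scalerA !mulrA.
    by rewrite divff ?gt_eqF// !mul1r.
have [f fq] := hahn_banach sq.
have f1 x : f x <= `|x|.
  apply: le_trans (fq x) _.
  by have := infle x 0 _ (lexx 0) Kk0; rewrite scale0r addr0 mul0r subr0.
have [|g gE] := @linear_bounded_dual _ f 1.
  by move=> x; rewrite mul1r ler_norml f1 andbT lerNl -linearN -normrN f1.
exists g => [x|k Kk]; rewrite gE// -lerN2 -linearN.
apply: le_trans (fq _) _; have := infle (- k) 1 _ ler01 Kk.
by rewrite scale1r addNr normr0 mul1r sub0r.
Qed.

Lemma norming_functional X (x : X) :
  exists2 f : dual X, dual_ball f & `|x| <= f x.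
Proof.
have [||k -> //|f fB fK] := @convex_separation X [set x] `|x|.
- by exists x.
- by move=> t _ _ _ _ -> ->; rewrite /= -scalerDl addrC subrK scale1r.
- by exists f => //; exact: fK.
Qed.

Lemma weak_cvgP X (F : set_system X) (l : X) : Filter F ->
  F --> (l : weak_topology X) <->
  forall f : dual X, f x @[x --> F] --> f l.
Proof.
move=> FF; split=> [/cvg_sup Fl f|Fl].
  have /= fc := @initial_continuous X R^o (sval f : X -> R^o) l.
  exact: (cvg_comp _ _ (Fl f) fc).
apply/cvg_sup => f U.
have /= -> := @nbhsE (initial_topology (sval f : X -> R^o)) l.
case=> B [[C oC <-] Cl] /filterS; apply.
by apply: (Fl f); exact: open_nbhs_nbhs.
Qed.

Lemma weakly_convergesP X (x : nat -> X) (l : X) :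
  weakly_converges x l <->
  forall f : dual X, f (x n) @[n --> \oo] --> f l.
Proof. exact: weak_cvgP. Qed.

End Duality.

(** * Finite linear combinations *)

Section LinearCombinations.
Context {R : realType}.

Lemma lin_comb_zero (X : lmodType R) (a : nat -> X) (b : nat -> R) N M :
  (N <= M)%N -> (forall i, (N <= i)%N -> b i = 0) ->
  lin_comb a b M = lin_comb a b N.
Proof.
move=> NM b0; rewrite /lin_comb -!(big_mkord xpredT (fun i => b i *: a i)).
rewrite (@big_cat_nat _ _ _ N 0 M)//=.
rewrite [X in _ + X]big_nat_cond [X in _ + X]big1 ?addr0// => i.
by rewrite andbT => /andP[Ni _]; rewrite b0// scale0r.
Qed.

Definition truncate (b : nat -> R) N i := if (i < N)%N then b i else 0.

Lemma lin_comb_truncate (X : lmodType R) (a : nat -> X) (b : nat -> R) N M :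
  (N <= M)%N -> lin_comb a (truncate b N) M = lin_comb a b N.
Proof.
move=> NM; rewrite (lin_comb_zero _ NM); last first.
  by move=> i Ni; rewrite /truncate ltnNge Ni.
by apply: eq_bigr => i _; rewrite /truncate ltn_ord.
Qed.

Lemma lin_combD (X : lmodType R) (a : nat -> X) (b b' : nat -> R) N :
  lin_comb a (fun i => b i + b' i) N = lin_comb a b N + lin_comb a b' N.
Proof. by rewrite -big_split; apply: eq_bigr => i _; rewrite scalerDl. Qed.

Lemma lin_combZ (X : lmodType R) (a : nat -> X) (c : R) (b : nat -> R) N :
  lin_comb a (fun i => c * b i) N = c *: lin_comb a b N.
Proof. by rewrite scaler_sumr; apply: eq_bigr => i _; rewrite scalerA. Qed.

Lemma lin_comb_delta (X : lmodType R) (a : nat -> X) n :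
  lin_comb a (fun i => (i == n)%:R) n.+1 = a n.
Proof.
rewrite /lin_comb big_ord_recr/= eqxx scale1r big1 ?add0r// => i _.
by rewrite ltn_eqF// scale0r.
Qed.

Lemma big_nat_truncate (V : lmodType R) (b : nat -> R) (z : nat -> V) m N N' :
  (m <= N)%N -> (N <= N')%N ->
  \sum_(m <= i < N') truncate b N i *: z i = \sum_(m <= i < N) b i *: z i.
Proof.
move=> mN NN'; rewrite (@big_cat_nat _ _ _ N)//= [X in _ + X]big_nat_cond.
rewrite [X in _ + X]big1 ?addr0 => [|i].
  by apply: eq_big_nat => i /andP[_ iN]; rewrite /truncate iN.
by rewrite andbT => /andP[Ni _]; rewrite /truncate ltnNge Ni scale0r.
Qed.

Lemma lin_combB (X : lmodType R) (x : nat -> X) (b b' : nat -> R) N :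
  lin_comb x (fun i => b i - b' i) N = lin_comb x b N - lin_comb x b' N.
Proof. by rewrite -sumrB; apply: eq_bigr => i _; rewrite scalerBl. Qed.

Lemma lin_comb_shift (X : lmodType R) (x : nat -> X) a N p :
  lin_comb (fun n => x (n + p)%N) a N =
  lin_comb x (fun i => if (i < p)%N then 0 else a (i - p)%N) (N + p).
Proof.
pose c i := if (i < p)%N then 0 else a (i - p)%N.
rewrite -/c /lin_comb -(big_mkord xpredT (fun i => c i *: x i)).
rewrite -(big_mkord xpredT (fun i => a i *: x (i + p)%N)).
rewrite [RHS](@big_cat_nat _ _ _ p) ?leq_addl//= [X in X + _]big_nat_cond.
rewrite [X in X + _]big1 ?add0r => [|i].
  rewrite -{2}[p]add0n big_addn addnK; apply: eq_bigr => i _.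
  by rewrite /c ltnNge leq_addl addnK.
by rewrite andbT /c => /andP[_ ->]; rewrite scale0r.
Qed.

Lemma lin_comb_cvg (X : normedModType R) (x : nat -> X) n
    (b : nat -> nat -> R) (a : nat -> R) :
  (forall i, b k i @[k --> \oo] --> a i) ->
  lin_comb x (b k) n @[k --> \oo] --> lin_comb x a n.
Proof.
move=> ba; elim: n => [|n IH].
  rewrite [lin_comb x a 0]big_ord0 (_ : (fun k => _) = fun=> 0).
    exact: cvg_cst.
  by apply/funext => k; rewrite /lin_comb big_ord0.
rewrite [lin_comb x a n.+1]big_ord_recr/=.
rewrite (_ : (fun k => _) = fun k => lin_comb x (b k) n + b k n *: x n).
  by apply: cvgD => //; exact: cvgZr_tmp.
by apply/funext => k; rewrite /lin_comb big_ord_recr.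
Qed.

Lemma rat_approx (X : normedModType R) (a : nat -> X) (b : nat -> R) N (e : R) :
  0 < e -> exists c : seq rat,
    `|lin_comb a b N - lin_comb a (fun i => ratr c`_i) (size c)| <= e.
Proof.
move=> e0; pose S := 1 + \sum_(i < N) `|a i|.
have S0 : 0 < S by rewrite ltr_pwDl// sumr_ge0.
have d0 : 0 < e / S by rewrite divr_gt0.
have /choice[q qP] : forall i, exists q : rat, `|b i - ratr q| <= e / S.
  move=> i; have [|q] := @rat_in_itvoo R (b i - e / S) (b i).
    by rewrite ltrBlDr ltrDl.
  rewrite in_itv/= => /andP[q1 q2]; exists q.
  by rewrite ger0_norm ?subr_ge0 ?ltW//; lra.
exists (mkseq q N); rewrite size_mkseq /lin_comb -sumrB.
apply: le_trans (ler_norm_sum _ _ _) _.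
apply: (@le_trans _ _ (\sum_(i < N) (e / S) * `|a i|)).
  apply: ler_sum => i _; rewrite nth_mkseq// -scalerBl normrZ.
  by rewrite ler_wpM2r.
rewrite -mulr_sumr -mulrA ler_piMr ?(ltW e0)// mulrC ler_pdivrMr// mul1r.
by rewrite /S lerDr.
Qed.

End LinearCombinations.

(** * Weak compactness and weakly convergent subsequences *)

Section Eberlein.
Context {R : realType}.

Lemma ultra_bounded_cvg T (F : set_system T) (u : T -> R) (M : R) :
  UltraFilter F -> F [set x | `|u x| <= M] ->
  exists l : R, u x @[x --> F] --> l.
Proof.
move=> FU FM.
have /(_ (u x @[x --> F]))[|l [_ lcl]] := @segment_compact R (- M) M.
  apply: (@filterS _ F _ _ (u @^-1` `[- M, M]) _ FM) => x /=.
  by rewrite ler_norml in_itv.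
exists l => U lU; have [//|FU'] := in_ultra_setVsetC (u @^-1` U) FU.
by have [y []] := lcl (~` U) U FU' lU.
Qed.

(** The limit phi along the functionals is an element of the bidual. If it is at
    distance zero from X, then points of X approximating it uniformly on the
    dual ball form a Cauchy sequence, and their limit evaluates to phi. *)
Lemma weak_limit_gap (X : completeNormedModType R) (F : set_system X)
    (phi : dual X -> R) : ProperFilter F ->
  (forall f : dual X, f x @[x --> F] --> phi f) ->
  (exists y : X, F --> (y : weak_topology X)) \/
  exists2 e : R, 0 < e & forall y, exists2 f : dual X, dual_ball f &
    e < phi f - f y.
Proof.
move=> FF Fphi; have [gap|nogap] := pselect (exists2 e : R, 0 < e & forall y,
  exists2 f : dual X, dual_ball f & e < phi f - f y); [by right|left].
have phiZ (f g : dual X) (c : R) : (forall x, g x = c * f x) ->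
    phi g = c * phi f.
  move=> gE; have cf : g x @[x --> F] --> c * phi f.
    rewrite (_ : (fun x => _) = (fun x => c * f x)); last exact/funext.
    exact: cvgMr.
  exact: (cvg_unique _ (Fphi g) cf).
have near_pt (e : R) : 0 < e -> exists y, forall f : dual X, dual_ball f ->
    `|phi f - f y| <= e.
  move=> e0; apply: contrapT => far; apply: nogap; exists e => // y.
  apply: contrapT => nof; apply: far; exists y => f fB.
  have le_e (g : dual X) : dual_ball g -> phi g - g y <= e.
    by move=> gB; rewrite leNgt; apply/negP => eg; apply: nof; exists g.
  have [g gB gE] := dual_ball_opp fB.
  have gE1 x : g x = -1 * f x by rewrite gE mulN1r.
  have := le_e _ gB; rewrite (phiZ _ _ _ gE1) gE => le_g.
  have := le_e _ fB => le_f; rewrite ler_norml; apply/andP; split; lra.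
have /choice[y yP] : forall n, exists y, forall f : dual X, dual_ball f ->
    `|phi f - f y| <= harmonic n.
  by move=> n; apply: near_pt; rewrite /harmonic/= invr_gt0.
have ydist n m : `|y n - y m| <= (harmonic n + harmonic m : R).
  have [f fB nf] := norming_functional (y n - y m); apply: le_trans nf _.
  have /ler_normlP[] := yP n f fB; have /ler_normlP[] := yP m f fB.
  rewrite dualB; lra.
have harm := @cvg_harmonic R.
have ycauchy : cauchy (y @ \oo).
  apply: cauchy_exP => e e0; have e2 : 0 < e / 2 by rewrite divr_gt0.
  have /cvgrPdist_lt/(_ _ e2) [N _ NP] := harm.
  have small n : (N <= n)%N -> harmonic n < e / 2.
    by move=> /NP; rewrite /= sub0r normrN ger0_norm ?harmonic_ge0.
  exists (y N); exists N => // n Nn /=; rewrite -ball_normE /=.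
  apply: le_lt_trans (ydist _ _) _; rewrite [e]splitr.
  by apply: ltrD; apply: small.
have /cauchy_cvg/cvg_ex[/= l yl] := ycauchy.
exists l; apply/weak_cvgP => f.
have phil (g : dual X) : dual_ball g -> phi g = g l.
  move=> gB.
  have c1 : g (y n) @[n --> \oo] --> g l.
    exact: (cvg_comp _ _ yl (svalP g l)).
  have c2 : g (y n) @[n --> \oo] --> phi g.
    apply/cvgrPdist_lt => e e0; move/cvgrPdist_lt: harm => /(_ _ e0).
    apply: filterS => n; rewrite sub0r normrN ger0_norm ?harmonic_ge0// => ne.
    exact: le_lt_trans (yP n g gB) ne.
  exact: (cvg_unique _ c2 c1).
have [M M0 [g gB gE]] := dual_normalize f.
by rewrite gE -(phil g gB) -(phiZ _ _ _ gE).
Qed.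

Lemma history_choice T (P : seq T -> T -> Prop) :
  (forall s, exists t, P s t) ->
  exists a : nat -> T, forall n, P (mkseq a n) (a n).
Proof.
move=> /choice[pick pickP].
pose hist := fix hist n :=
  if n is m.+1 then rcons (hist m) (pick (hist m)) else [::].
exists (fun n => pick (hist n)) => n.
suff -> : mkseq (fun n => pick (hist n)) n = hist n by exact: pickP.
by elim: n => [//|n IH]; rewrite mkseqS IH.
Qed.

Lemma cvg_ge_id (psi : nat -> nat) : (forall n, (n <= psi n)%N) ->
  psi n @[n --> \oo] --> \oo.
Proof.
move=> psi_ge A [m _ mA]; exists m => // n mn; apply: mA.
exact: leq_trans mn (psi_ge n).
Qed.

(** Otherwise a functional separates l from the span of the sequence, hence from
    the sequence itself. *)
Lemma weak_limit_in_span (X : normedModType R) (a : nat -> X)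
    (psi : nat -> nat) (l : X) (e : R) :
  0 < e -> weakly_converges (a \o psi) l ->
  exists b N, `|l - lin_comb a b N| < e.
Proof.
move=> e0 /weakly_convergesP al; apply: contrapT => far.
pose K := [set v | exists b N, v = l - lin_comb a b N].
have [|t _ _ _ _ [b [N ->]] [b' [N' ->]]|k [b [N ->]]|f fB fK] :=
  @convex_separation _ X K e.
- by exists (l - lin_comb a (fun=> 0) 0), (fun=> 0), 0%N.
- exists (fun i => t * truncate b N i + (1 - t) * truncate b' N' i).
  exists (maxn N N').
  rewrite lin_combD !lin_combZ !lin_comb_truncate ?leq_maxl ?leq_maxr//.
  rewrite !scalerBr addrACA -scalerDl [t + _]addrC subrK scale1r.
  by rewrite -opprD.
- by rewrite leNgt; apply/negP => lt_e; apply: far; exists b, N.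
- have ge_e n : e <= f l - f (a n).
    rewrite -dualB; apply: fK; exists (fun i => (i == n)%:R), n.+1.
    by rewrite lin_comb_delta.
  have /cvgrPdist_lt/(_ _ e0) [N _ /(_ N (leqnn N))] := al f.
  rewrite /= => /ltr_normlW; rewrite ltNge; apply/negP/negPn; exact: ge_e.
Qed.

(** Let phi be the limit along the functionals of an ultrafilter on C without
    weak limit, and let y range over the rational combinations of the sequence
    under construction. A functional g_y of the dual ball with
    phi g_y > g_y y + e is attached to each y, and the points a_n are chosen so
    that g_y a_n tends to phi g_y for all these countably many y. A weak limit
    of a subsequence would be within e of some y, and g_y tells the two apart by
    more than e. *)
Lemma eberlein_smulian (X : completeNormedModType R) (C : set X) :
  bounded_set C -> closed C -> convex_subset C -> ~ weakly_compact C ->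
  exists a : nat -> X, (forall n, C (a n)) /\
    forall psi : nat -> nat, (forall n, (n <= psi n)%N) ->
      forall l, ~ weakly_converges (a \o psi) l.
Proof.
move=> Cb Ccl Cc; rewrite /weakly_compact compact_ultra.
move=> /existsNP[F /not_implyP[FU /not_implyP[FC noF]]].
have FF : ProperFilter (F : set_system X) by exact: ultra_proper.
have [M M0 CM] : exists2 M : R, 0 < M & forall x, C x -> `|x| <= M.
  by have /pinfty_ex_gt0[M M0 CM] := Cb; exists M.
have /choice[phi phiP] (f : dual X) :
    exists p : R, f x @[x --> (F : set_system X)] --> p.
  have [K K0 fK] := dual_bounded f.
  apply: (@ultra_bounded_cvg _ _ f (K * M)) => //.
  apply: filterS FC => x Cx; apply: le_trans (fK x) _.
  by rewrite ler_wpM2l ?(ltW K0)// CM.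
have [[y Fy]|[e e0 gap]] := weak_limit_gap FF phiP.
  (* a weak limit of F outside C would be separated from the closed convex C *)
  exfalso; apply: noF; exists y; split=> //=.
  apply: contrapT => Cy.
  have : nbhs y (~` C).
    by apply: open_nbhs_nbhs; split=> //; exact: closed_openC.
  move=> /nbhs_ballP[d /= d0 yd].
  have C0 : C !=set0 by exact: (@filter_ex _ (F : set_system X) FF).
  have [|t _ _ t0 t1 [x Cx <-] [x' Cx' <-]|k [x Cx <-]|f fB fK] :=
    @convex_separation _ X [set x - y | x in C] d.
  + by case: C0 => x Cx; exists (x - y), x.
  + exists (t *: x + (1 - t) *: x'); first exact: Cc.
    by rewrite !scalerBr addrACA -opprD -scalerDl [t + _]addrC subrK scale1r.
  + rewrite leNgt; apply/negP => xyd; apply: (yd x) => //.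
    by rewrite -ball_normE /= distrC.
  + move/weak_cvgP : Fy => /(_ f) /cvgrPdist_lt/(_ _ d0) Fd.
    have [x [Cx xd]] := @filter_ex _ _ FF _ (filterI FC Fd).
    have : d <= f (x - y) by apply: fK; exists x.
    by rewrite dualB leNgt (le_lt_trans (ler_norm _))// distrC.
have /choice[g gP] y : exists f : dual X, dual_ball f /\ e < phi f - f y.
  by have [f fB fy] := gap y; exists f.
have [gB gphi] : (forall y, dual_ball (g y)) /\
    forall y, e < phi (g y) - g y y by split=> y; have [] := gP y.
(* When c is longer than s, the missing vectors default to 0; this only matters
   for the finitely many stages preceding the size of c. *)
pose comb (c : seq rat) (s : seq X) :=
  lin_comb (nth 0 s) (fun i => ratr c`_i : R) (size c).
pose close (s : seq X) (t : X) k := forall c, unpickle k = Some c ->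
  `|phi (g (comb c s)) - g (comb c s) t| < harmonic (size s).
pose P (s : seq X) (t : X) :=
  C t /\ forall k, (k < size s)%N -> close s t k.
have [s|a aP] := @history_choice _ P.
  suff [t [Ct tP]] :
      (C `&` [set t | forall k : 'I_(size s), close s t k]) !=set0.
    by exists t; split=> // k ks; exact: (tP (Ordinal ks)).
  apply: (@filter_ex _ _ FF); apply: filterI => //; apply: filter_forall => k.
  rewrite /close; case: (unpickle k) => [c|]; last exact: filterE.
  move/cvgrPdist_lt : (phiP (g (comb c s))) => /(_ _ (harmonic_gt0 (size s))).
  by apply: filterS => t tc c' [<-].
exists a; split=> [n|psi psi_ge l al]; first by have [] := aP n.
have e2 : 0 < e / 2 by rewrite divr_gt0.
have [b [N lb]] := weak_limit_in_span e2 al.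
have [c bc] := rat_approx a b N e2.
set y := lin_comb a _ (size c) in bc.
have ly : `|l - y| < e.
  rewrite [e]splitr -(subrK (lin_comb a b N) l) -addrA.
  by apply: le_lt_trans (ler_normD _ _) _; rewrite ltr_leD.
have phi_lim : g y (a n) @[n --> \oo] --> phi (g y).
  apply/cvgrPdist_lt => d d0; have /cvgrPdist_lt/(_ _ d0) hd := @cvg_harmonic R.
  near=> n.
  have combE : comb c (mkseq a n) = y.
    have cn : (size c <= n)%N by near: n; exact: nbhs_infty_ge.
    rewrite /comb /y; apply: eq_bigr => i _; rewrite nth_mkseq//.
    exact: leq_trans (ltn_ord i) cn.
  have [_] := aP n; rewrite /close size_mkseq => /(_ (pickle c) _ c).
  rewrite pickleK combE => /(_ _ erefl) an.
  apply: lt_trans (an _) _; first by near: n; exact: nbhs_infty_gt.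
  have : `|0 - harmonic n| < d by near: n.
  by rewrite sub0r normrN ger0_norm ?harmonic_ge0.
have phil : g y l = phi (g y).
  have gl := (weakly_convergesP _ _).1 al (g y).
  exact: (cvg_unique _ gl (cvg_comp _ _ (cvg_ge_id psi_ge) phi_lim)).
have := gphi y; rewrite -phil -dualB ltNge => /negP; apply.
by apply: le_trans (gB y _) _; exact: ltW.
Unshelve. all: by end_near. Qed.

End Eberlein.

(** * Extraction of subsequences *)

Section Subsequences.

Definition unbounded (M : set nat) := forall N, exists2 n, (N <= n)%N & M n.

Lemma unboundedS (M M' : set nat) : M `<=` M' -> unbounded M -> unbounded M'.
Proof.
by move=> MM' uM N; have [n Nn Mn] := uM N; exists n => //; exact: MM'.
Qed.

Lemma unbounded_tail (M : set nat) m : unbounded M ->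
  unbounded (M `&` [set n | (m <= n)%N]).
Proof.
move=> uM N; have [n] := uM (maxn N m); rewrite geq_max => /andP[Nn mn] Mn.
by exists n.
Qed.

Lemma not_unbounded (M : set nat) : ~ unbounded M ->
  exists N, forall n, (N <= n)%N -> ~ M n.
Proof.
by move=> /existsNP[N MN]; exists N => n Nn Mn; apply: MN; exists n.
Qed.

Lemma strictly_increasing_ge (f : nat -> nat) :
  (forall k, (f k < f k.+1)%N) -> forall k, (k <= f k)%N.
Proof. by move=> fS; elim=> [//|k IH]; exact: leq_ltn_trans IH (fS k). Qed.

Lemma infinite_pigeonhole (T : eqType) (l : seq T) (c : nat -> T) :
  (forall k, c k \in l) -> exists v, unbounded [set k | c k = v].
Proof.
move=> cl; apply: contrapT => /forallNP none.
have /choice[N NP] v : exists N, forall k, (N <= k)%N -> c k <> v.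
  by apply: (@not_unbounded [set k | c k = v]) => uv; apply: (none v).
pose m := (\max_(v <- l) N v)%N.
by apply: (NP (c m) m) => //; exact: leq_bigmax_seq.
Qed.

(** The diagonal extraction: thin out the current set at each stage and pick the
    next point in what remains, so that the later points lie in all of the
    chosen sets. *)
Lemma fusion (P : nat -> nat -> set nat -> Prop) (M0 : set nat) :
  unbounded M0 ->
  (forall k n M, M0 n -> M `<=` M0 -> unbounded M ->
     exists M', [/\ M' `<=` M, unbounded M' & P k n M']) ->
  exists n : nat -> nat, [/\ forall k, M0 (n k), forall k, (n k < n k.+1)%N &
    forall k, exists2 M, P k (n k) M & forall l, (k < l)%N -> M (n l)].
Proof.
move=> uM0 step.
have /choice[next nextP] (x : set nat * nat) :
    exists n, unbounded x.1 -> (x.2 <= n)%N /\ x.1 n.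
  have [uM|nu] := pselect (unbounded x.1); last by exists 0%N.
  by have [n] := uM x.2; exists n.
have /choice[thin thinP] (x : nat * nat * set nat) : exists M',
    M0 x.1.2 -> x.2 `<=` M0 -> unbounded x.2 ->
    [/\ M' `<=` x.2, unbounded M' & P x.1.1 x.1.2 M'].
  have [[a [b c]]|h] :=
    pselect (M0 x.1.2 /\ x.2 `<=` M0 /\ unbounded x.2).
    by have [M' ?] := step x.1.1 _ _ a b c; exists M'.
  by exists set0 => a b c; exfalso; apply: h.
pose st := fix st k := if k is j.+1 then
    let n := next ((st j).2, (st j).1.+1) in (n, thin (k, n, (st j).2))
  else let n := next (M0, 0%N) in (n, thin (0%N, n, M0)).
have stP k : [/\ M0 (st k).1, (st k).2 `<=` M0, unbounded (st k).2 &
    P k (st k).1 (st k).2].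
  elim: k => [|k [IH1 IH2 IH3 _]] /=.
    have [/= _ Mn] := nextP (M0, 0%N) uM0.
    by have [] := thinP (0%N, next (M0, 0%N), M0) Mn (fun _ h => h) uM0.
  have [/= _ /IH2 Mn] := nextP ((st k).2, (st k).1.+1) IH3.
  have [/= sM uM PM] := thinP (k.+1, _, (st k).2) Mn IH2 IH3.
  by split=> //; exact: subset_trans IH2.
have stS k : [/\ ((st k).1 < (st k.+1).1)%N, (st k).2 (st k.+1).1 &
    (st k.+1).2 `<=` (st k).2].
  have [_ sM uM _] := stP k; have [Mn _ _ _] := stP k.+1.
  have [lt_n Mn'] := nextP ((st k).2, (st k).1.+1) uM.
  by have [] := thinP (k.+1, (st k.+1).1, (st k).2) Mn sM uM.
exists (fun k => (st k).1); split=> k; first by have [] := stP k.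
  by have [] := stS k.
exists (st k).2; first by have [] := stP k.
have sub d : (st (k + d)%N).2 `<=` (st k).2.
  elim: d => [|d IH]; first by rewrite addn0.
  by rewrite addnS; have [_ _ s] := stS (k + d)%N; exact: subset_trans s IH.
case=> // l; rewrite ltnS => kl.
by have [_ + _] := stS l; rewrite -{1}(subnKC kl) => /sub.
Qed.

End Subsequences.

(** * Rosenthal's dichotomy *)

Section Independence.
Context {T : Type} (W : bool -> nat -> T -> Prop).
Implicit Types (E : set T) (M : set nat).

Definition oscillates_at M (h : T) :=
  forall b, unbounded [set n | M n /\ W b n h].

(** No subsequence of M makes the pairs (W true n, W false n) settle down at all
    points of E. *)
Definition oscillating E M := forall M', M' `<=` M -> unbounded M' ->
  exists2 h, E h & oscillates_at M' h.

Lemma oscillatingS E M M' : M' `<=` M -> oscillating E M -> oscillating E M'.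
Proof. by move=> MM' oM M2 sM2; apply: oM; exact: subset_trans sM2 MM'. Qed.

Lemma not_oscillating E M : ~ oscillating E M -> exists M',
  [/\ M' `<=` M, unbounded M' & forall h, E h -> ~ oscillates_at M' h].
Proof.
move=> /existsNP[M' /not_implyP[sM /not_implyP[uM noh]]]; exists M'.
by split=> // h Sh oh; apply: noh; exists h.
Qed.

(** Rosenthal's splitting step. Otherwise each n in M spoils W b n within some E
    of the list, along a further subsequence; by fusion and the pigeonhole
    principle one pair (E, b) is spoiled by all the terms of a subsequence D,
    along the later terms of D. A point of E oscillating along D lies in W b n
    for some n in D, and this n spoils it. *)
Lemma oscillating_split (l : seq (set T)) M : unbounded M ->
  (forall E, E \in l -> oscillating E M) ->
  exists n M', [/\ M n, M' `<=` M, unbounded M' &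
    forall E b, E \in l -> oscillating (E `&` W b n) M'].
Proof.
move=> uM lM; apply: contrapT => nosplit.
pose spoil (Sb : set T * bool) n M' :=
  forall h, Sb.1 h -> W Sb.2 n h -> ~ oscillates_at M' h.
pose L := [seq (E, b) | E <- l, b <- [:: true; false]].
pose P (k n : nat) M' := exists2 Sb, Sb \in L & spoil Sb n M'.
have [|n [Mn nS nP]] := @fusion P M uM.
  move=> k n M1 Mn M1M uM1; apply: contrapT => noM'.
  apply: nosplit; exists n, M1; split=> // E b Sl.
  apply: contrapT => /not_oscillating[M' [sM' uM' M'P]].
  apply: noM'; exists M'; split=> //; exists (E, b); last first.
    by move=> h Sh Wh; exact: M'P.
  by apply/allpairsP; exists (E, b); split=> //=; case: (b); rewrite !inE.
have /choice[c cP] k : exists Sb, Sb \in L /\ exists2 M', spoil Sb (n k) M' &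
    forall j, (k < j)%N -> M' (n j).
  by have [M' [Sb SbL sp] M'n] := nP k; exists Sb; split=> //; exists M'.
have [[E b] cv] := infinite_pigeonhole (fun k => (cP k).1).
have Sl : E \in l.
  have [k _ /= ck] := cv 0%N; have [+ _] := cP k; rewrite ck => /allpairsP.
  by case=> -[E' b'] [/= E'l _ [-> _]].
pose D := [set n k | k in [set k | c k = (E, b)]].
have [||h Sh hD] := lM E Sl D.
- by move=> _ [k _ <-].
- move=> N; have [k Nk ck] := cv N; exists (n k); last by exists k.
  exact: leq_trans Nk (strictly_increasing_ge nS k).
have [_ _ [[k /= ck <-] Wk]] := hD b 0%N.
have [_] := cP k; rewrite ck => -[M' sp M'n].
apply: (sp h Sh Wk) => b' N.
have [nj Nj [Dj Wj]] := hD b' (maxn N (n k).+1).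
case: Dj Nj Wj => j _ <-; rewrite geq_max => /andP[Nj kj] Wj.
exists (n j) => //; split=> //.
apply: M'n; rewrite ltnNge; apply/negP => jk.
have nmono : {homo n : x y / (x <= y)%N}.
  by apply: homo_leq => [//|? ? ?|i]; [exact: leq_trans|exact: ltnW].
by have := leq_trans kj (nmono _ _ jk); rewrite ltnn.
Qed.

(** Iterating the splitting step keeps all the 2^k cells cut out by the first k
    pairs oscillating, in particular nonempty. *)
Lemma oscillating_independent E0 M : unbounded M -> oscillating E0 M ->
  exists2 n : nat -> nat, (forall k, (n k < n k.+1)%N) &
    forall (s : nat -> bool) N, exists2 h, E0 h &
      forall i, (i < N)%N -> W (s i) (n i) h.
Proof.
move=> uM oM.
pose state := (nat * seq (set T) * set nat)%type.
pose inv (x : state) := [/\ unbounded x.2, forall n, x.2 n -> (x.1.1 < n)%N &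
  forall E, E \in x.1.2 -> oscillating E x.2].
pose next (x y : state) := [/\ x.2 y.1.1, inv y &
  forall E b, E \in x.1.2 -> E `&` W b y.1.1 \in y.1.2].
have /choice[f fP] (x : state) : exists y, inv x -> next x y.
  have [[uN ltN lN]|] := pselect (inv x); last by exists x.
  have [n [M' [Nn sM uM' M'P]]] := oscillating_split uN lN.
  pose l' := [seq E `&` W b n | E <- x.1.2, b <- [:: true; false]].
  exists (n, l', M' `&` [set m | (n < m)%N]) => _; split=> //; first split.
  - exact: unbounded_tail.
  - by move=> m [].
  - move=> F /allpairsP[[E b] [/= Sl _ ->]].
    by apply: oscillatingS (M'P _ b Sl) => m [].
  - move=> E b Sl; apply/allpairsP; exists (E, b); split=> //=.
    by case: (b); rewrite !inE.
pose x0 : state := (0%N, [:: E0], M `&` [set m | (0 < m)%N]).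
have inv0 : inv x0.
  split=> /=; [exact: unbounded_tail|by move=> m []|].
  by move=> E; rewrite inE => /eqP ->; apply: oscillatingS oM => m [].
pose st k := iter k f x0.
have stI k : inv (st k) by elim: k => [//|k /fP[]].
have stN k : next (st k) (st k.+1) by exact: fP.
exists (fun k => (st k.+1).1.1) => [k|s N].
  by have [_ lt_n _] := stI k.+1; apply: lt_n; have [] := stN k.+1.
have [E Sl SP] : exists2 E, E \in (st N).1.2 & E `<=` E0 `&`
    [set h | forall i, (i < N)%N -> W (s i) (st i.+1).1.1 h].
  elim: N => [|N [E Sl SP]].
    by exists E0; rewrite ?inE//; split.
  have [_ _ SN] := stN N; exists (E `&` W (s N) (st N.+1).1.1); first exact: SN.
  move=> h [/SP[S0h hN] WN]; split=> // i; rewrite ltnS leq_eqVlt.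
  by case/predU1P => [->|/hN].
have [uN _ oN] := stI N; have [h /SP[S0h hN] _] := oN E Sl _ (fun _ m => m) uN.
by exists h.
Qed.

End Independence.

Section RealSequences.
Context {R : realType}.

(** The limit is the upper limit of u, the supremum of the levels t which u
    exceeds infinitely often. *)
Lemma cvg_no_oscillation (u : nat -> R) (M : R) : (forall n, `|u n| <= M) ->
  (forall r s : rat, r < s -> ~ (unbounded [set n | ratr s < u n] /\
     unbounded [set n | u n < ratr r])) -> cvg (u n @[n --> \oo]).
Proof.
move=> uM noosc.
pose E := [set t | unbounded [set n | t < u n]].
have EM : E (- M - 1).
  move=> N; exists N => //=; have /ler_normlP[] := uM N; lra.
have Eub : ubound E M.
  move=> t /(_ 0%N)[n _ /= /ltW/le_trans]; apply.
  by have /ler_normlP[] := uM n.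
have supE : has_sup E by split; [exists (- M - 1)|exists M].
apply/cvg_ex; exists (sup E); apply/cvgrPdist_le => e e0.
have e2 : 0 < e / 2 by rewrite divr_gt0.
have /not_unbounded[N1 N1P] : ~ E (sup E + e).
  by move=> /(ub_le_sup supE.2); rewrite leNgt ltrDl e0.
have [t Et tE] := sup_adherent e2 supE.
have [s] := rat_in_itvoo tE; rewrite in_itv/= => /andP[s1 s2].
have lt_r : sup E - e < sup E - e / 2 by lra.
have [r] := rat_in_itvoo lt_r; rewrite in_itv/= => /andP[r1 r2].
have rs : r < s by rewrite -(ltr_rat R); exact: lt_trans s1.
have /not_unbounded[N2 N2P] : ~ unbounded [set n | u n < ratr r].
  move=> ur; apply: (noosc r s rs); split=> //.
  by apply: unboundedS Et => n; exact: lt_trans.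
exists (maxn N1 N2) => // n /=; rewrite geq_max => /andP[n1 n2].
have /negP := N1P n n1; have /negP := N2P n n2; rewrite -!leNgt => ge_r le_e.
rewrite ler_norml; apply/andP; split; lra.
Qed.

(** For each rational pair, either every subsequence leaves some function
    oscillating across it, and the independence lemma applies, or a subsequence
    settles this pair; in the latter case for all pairs, the diagonal
    subsequence settles all of them. *)
Lemma rosenthal_dichotomy (T : Type) (u : T -> nat -> R) (M : R) :
  (forall h n, `|u h n| <= M) ->
  (exists2 n : nat -> nat, (forall k, (n k < n k.+1)%N) &
     forall h, cvg (u h (n k) @[k --> \oo])) \/
  (exists r s : R, r < s /\
     exists2 n : nat -> nat, (forall k, (n k < n k.+1)%N) &
       forall (b : nat -> bool) N, exists h, forall i, (i < N)%N ->
         if b i then s <= u h (n i) else u h (n i) <= r).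
Proof.
move=> uM.
pose W (rs : rat * rat) (b : bool) n (h : T) :=
  if b then ratr rs.2 < u h n else u h n < ratr rs.1.
have [[rs [lt_rs [M0 uM0 oM0]]]|noosc] := pselect (exists rs : rat * rat,
    rs.1 < rs.2 /\ exists2 M0, unbounded M0 & oscillating (W rs) setT M0).
  right; exists (ratr rs.1), (ratr rs.2); split; first by rewrite ltr_rat.
  have [n nS nP] := oscillating_independent uM0 oM0; exists n => // b N.
  have [h _ hP] := nP b N; exists h => i iN; have := hP i iN; rewrite /W.
  by case: (b i) => /ltW.
left.
pose P (k n : nat) M' := forall rs : rat * rat,
  unpickle k = Some rs -> rs.1 < rs.2 ->
  forall h, ~ oscillates_at (W rs) M' h.
have [||n [_ nS nP]] := @fusion P setT.
- by move=> N; exists N.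
- move=> k n M1 _ _ uM1.
  have [[rs [urs lt_rs]]|nors] := pselect (exists rs : rat * rat,
      unpickle k = Some rs /\ rs.1 < rs.2); last first.
    by exists M1; split=> // rs urs lt_rs; exfalso; apply: nors; exists rs.
  have [M' [sM' uM' M'P]] : exists M', [/\ M' `<=` M1, unbounded M' &
      forall h, setT h -> ~ oscillates_at (W rs) M' h].
    apply: not_oscillating => oM1; apply: noosc; exists rs; split=> //.
    by exists M1.
  by exists M'; split=> // rs'; rewrite urs => -[<-] _ h; exact: M'P.
exists n => // h; apply: (@cvg_no_oscillation _ M) => // r s rs [us ur].
have [M' M'P M'n] := nP (pickle (r, s)).
apply: (M'P _ (pickleK _) rs h) => b N.
have nge := strictly_increasing_ge nS.
have ub : unbounded [set k | W (r, s) b (n k) h] by case: b.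
have [k] := ub (maxn N (pickle (r, s)).+1); rewrite geq_max => /andP[Nk kk] Wk.
exists (n k); first exact: leq_trans Nk (nge k).
by split=> //; exact: M'n.
Qed.

End RealSequences.

(** * Norms of the model sequences *)

Section SequenceNorms.
Context {R : realType}.

Lemma lin_comb_unit_vector (a : nat -> R) N j :
  lin_comb (@unit_vector R) a N j = truncate a N j.
Proof.
rewrite /lin_comb fct_sumE /truncate.
rewrite (eq_bigr (fun i : 'I_N => a i * (j == i)%:R)) //; case: ltnP => [jN|Nj].
  rewrite (bigD1 (Ordinal jN))//= eqxx mulr1 big1 ?addr0// => i ij.
  rewrite (_ : (j == i :> nat) = false) ?mulr0//.
  by apply/negbTE; apply: contra ij => /eqP ij; apply/eqP/val_inj.
rewrite big1// => i _; rewrite gtn_eqF ?mulr0//.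
exact: leq_trans (ltn_ord i) Nj.
Qed.

Lemma l1_norm_lin_comb (a : nat -> R) N :
  l1_norm (lin_comb (@unit_vector R) a N) = \sum_(i < N) `|a i|.
Proof.
apply: cvg_lim => //; apply: cvg_near_cst; exists N => // n /= Nn.
rewrite /series /= (@big_cat_nat _ _ _ N)//= [X in _ + X]big_nat_cond.
rewrite [X in _ + X]big1 ?addr0 => [|i]; last first.
  rewrite andbT => /andP[Ni _].
  by rewrite lin_comb_unit_vector /truncate ltnNge Ni normr0.
rewrite big_mkord; apply: eq_bigr => i _.
by rewrite lin_comb_unit_vector /truncate ltn_ord.
Qed.

Lemma lin_comb_summing_basis (a : nat -> R) N j :
  lin_comb (@summing_basis R) a N j = \sum_(j <= i < N) a i.
Proof.
have sbE i : summing_basis i j = (j <= i)%N%:R :> R.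
  rewrite /summing_basis fct_sumE.
  rewrite (eq_bigr (fun k : 'I_i.+1 => if k == j :> nat then 1 else 0)).
    2: by move=> k _; rewrite /unit_vector eq_sym; case: eqP.
  rewrite -big_mkcond/=; case: leqP => ji.
    rewrite (big_pred1 (inord j)) // => k /=.
    by rewrite -(inj_eq val_inj) /= inordK.
  rewrite big_pred0// => k; apply: ltn_eqF.
  exact: leq_trans (ltn_ord k) ji.
rewrite /lin_comb fct_sumE.
rewrite (eq_bigr (fun i : 'I_N => a i * (j <= i)%N%:R)); last first.
  by move=> i _; rewrite -sbE.
rewrite -(big_mkord xpredT (fun i => a i * (j <= i)%N%:R)).
have [jN|Nj] := leqP j N; last first.
  rewrite [RHS]big_geq ?(ltnW Nj)// big_nat_cond big1// => i.
  by rewrite andbT => /andP[_ iN]; rewrite leqNgt (ltn_trans iN Nj) mulr0.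
rewrite (@big_cat_nat _ _ _ j)//= [X in X + _]big_nat_cond.
rewrite [X in X + _]big1 ?add0r => [|i]; last first.
  by rewrite andbT => /andP[_ ij]; rewrite leqNgt ij mulr0.
by apply: eq_big_nat => i /andP[-> _]; rewrite mulr1.
Qed.

Lemma sup_norm_summing_le (a : nat -> R) N (D : R) :
  (forall m, (m <= N)%N -> `|\sum_(m <= i < N) a i| <= D) ->
  sup_norm (lin_comb (@summing_basis R) a N) <= D.
Proof.
move=> aD; apply: ge_sup.
  by exists `|lin_comb (@summing_basis R) a N 0|, 0%N.
move=> _ [j _ <-]; rewrite lin_comb_summing_basis.
have [/aD//|Nj] := leqP j N.
rewrite big_geq ?(ltnW Nj)// normr0.
by have := aD N (leqnn N); rewrite big_geq// normr0.
Qed.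

End SequenceNorms.

(** * Rosenthal's l1-theorem *)

Section RosenthalL1.
Context {R : realType} {X : normedModType R}.

(** Independence turns into a lower l1-estimate: with f large where a_i >= 0 and
    small elsewhere, and g the other way round, f - g has norm at most 2 and
    takes a value at least (s - r) sum |a_i| on the combination. *)
Lemma rosenthal_l1 (x : nat -> X) (M : R) : (forall n, `|x n| <= M) ->
  exists2 n : nat -> nat, (forall k, (n k < n k.+1)%N) &
    weak_cauchy (x \o n) \/ l1_sequence (x \o n).
Proof.
move=> xM.
pose u (f : {f : dual X | dual_ball f}) k := sval f (x k) : R.
have uM f k : `|u f k| <= M.
  exact: le_trans (dual_ball_norm (svalP f) (x k)) (xM k).
have [[n nS nP]|[r [s [rs [n nS nP]]]]] := rosenthal_dichotomy uM.
  exists n => //; left=> f; have [K K0 [g gB gE]] := dual_normalize f.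
  apply: cvg_cauchy; have := nP (exist _ g gB) => /cvg_ex[/= l ul].
  apply/cvg_ex; exists (K * l).
  have -> : (fun k => sval f ((x \o n) k)) =
      (fun k => K * u (exist _ g gB) (n k)).
    by apply/funext => k; exact: gE.
  exact: cvgMr.
exists n => //; right.
have rs0 : 0 < s - r by rewrite subr_gt0.
pose L := Num.max 1 (Num.max M (2 / (s - r))).
have L1 : 1 <= L by rewrite le_max lexx.
have L0 : 0 < L by exact: lt_le_trans L1.
exists L => // a N; rewrite l1_norm_lin_comb; split.
  rewrite ler_pdivrMl//; apply: le_trans (ler_norm_sum _ _ _) _.
  rewrite mulr_sumr; apply: ler_sum => i _; rewrite normrZ mulrC ler_wpM2r//.
  by apply: le_trans (xM _) _; rewrite !le_max lexx orbT.
have [f fP] := nP (fun i => 0 <= a i) N.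
have [g gP] := nP (fun i => ~~ (0 <= a i)) N.
have key : (s - r) * \sum_(i < N) `|a i| <=
    sval f (lin_comb (x \o n) a N) - sval g (lin_comb (x \o n) a N).
  rewrite !dual_lin_comb -sumrB mulr_sumr; apply: ler_sum => i _.
  rewrite -mulrBr; have := fP i (ltn_ord i); have := gP i (ltn_ord i).
  rewrite /u; case: (leP 0 (a i)) => /= ai ge_s le_r; last first.
    rewrite ltr0_norm// mulrC -[leRHS]opprK -mulNr -mulrN.
    by rewrite ler_wpM2l ?oppr_ge0 ?(ltW ai)//; lra.
  rewrite ger0_norm// mulrC ler_wpM2l//; lra.
have fg : sval f (lin_comb (x \o n) a N) - sval g (lin_comb (x \o n) a N) <=
    2 * `|lin_comb (x \o n) a N|.
  have := svalP f (lin_comb (x \o n) a N).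
  have := dual_ball_norm (svalP g) (lin_comb (x \o n) a N).
  by move=> /ler_normlP[]; lra.
have : \sum_(i < N) `|a i| <= (2 / (s - r)) * `|lin_comb (x \o n) a N|.
  rewrite mulrAC ler_pdivlMr// mulrC.
  exact: le_trans key fg.
move=> /le_trans; apply; rewrite ler_wpM2r//.
by rewrite !le_max lexx !orbT.
Qed.

End RosenthalL1.

(** * Recognizing basic and wide-(s) sequences *)

Section BasicCriterion.
Context {R : realType} {X : completeNormedModType R}.

Lemma seriesE (x : nat -> X) (a : nat -> R) :
  series (fun i => a i *: x i) = lin_comb x a.
Proof. by apply/funext => n; rewrite /series /= big_mkord. Qed.

(** The coefficients and the partial sums of approximants of v in the span
    converge, uniformly in the length of the partial sums; their limit is the
    expansion of v. *)
Lemma basic_sequence_criterion (x : nat -> X) (K D : R) : 0 <= K -> 0 <= D ->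
  (forall a m N, (m <= N)%N -> `|lin_comb x a m| <= K * `|lin_comb x a N|) ->
  (forall a i N, (i < N)%N -> `|a i| <= D * `|lin_comb x a N|) ->
  basic_sequence x.
Proof.
move=> K0 D0 xK xD; split=> [n|v vcl].
  apply: subset_closure; exists (fun i => (i == n)%:R), n.+1.
  by rewrite lin_comb_delta.
have harm0 : harmonic n @[n --> \oo] --> (0 : R) := cvg_harmonic.
have /choice[bN bNP] k : exists bN : (nat -> R) * nat,
    `|v - lin_comb x bN.1 bN.2| < harmonic k.
  have [_ [[b [N ->]] /=]] := vcl _ (nbhsx_ballx v _ (harmonic_gt0 k)).
  by rewrite -ball_normE /= => vb; exists (b, N).
pose b k := truncate (bN k).1 (bN k).2.
pose w k := lin_comb x (bN k).1 (bN k).2.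
have bw k n : ((bN k).2 <= n)%N -> lin_comb x (b k) n = w k.
  exact: lin_comb_truncate.
have vw k : `|v - w k| <= harmonic k by apply: ltW; exact: bNP.
have ww k l : `|w k - w l| <= harmonic k + harmonic l.
  apply: le_trans (ler_distD v _ _) _; rewrite lerD//.
  by rewrite distrC.
have harm_small (e : R) : 0 < e ->
    exists k, forall l, (k <= l)%N -> harmonic l < e.
  move=> e0; move/cvgrPdist_lt : harm0 => /(_ _ e0)[k _ kP]; exists k => l /kP.
  by rewrite /= sub0r normrN ger0_norm ?harmonic_ge0.
have bb k l i : `|b k i - b l i| <= D * (harmonic k + harmonic l).
  pose m := maxn i.+1 (maxn (bN k).2 (bN l).2).
  have := xD (fun i => b k i - b l i) i m (leq_maxl _ _).
  rewrite lin_combB !bw; last 2 first.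
  - by rewrite !leq_max leqnn !orbT.
  - by rewrite !leq_max leqnn !orbT.
  by move=> /le_trans; apply; rewrite ler_wpM2l.
have /choice[a aP] (i : nat) : exists a : R, b k i @[k --> \oo] --> a.
  apply/cvg_ex; apply: cauchy_cvg; apply: cauchy_exP => e e0.
  have e2 : 0 < (D + 1)^-1 * e / 2.
    by rewrite divr_gt0// mulr_gt0// invr_gt0 ltr_pwDr.
  have [k kP] := harm_small _ e2; exists (b k i); exists k => // l kl /=.
  rewrite -ball_normE /=; apply: le_lt_trans (bb _ _ _) _.
  apply: (@le_lt_trans _ _ ((D + 1) * (harmonic k + harmonic l))).
    by rewrite ler_wpM2r ?addr_ge0 ?harmonic_ge0// lerDl.
  rewrite -ltr_pdivlMl ?ltr_pwDr//.
  by rewrite [ltRHS]splitr ltrD// kP.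
have wa k n : ((bN k).2 <= n)%N ->
    `|v - lin_comb x a n| <= (K + 1) * harmonic k.
  move=> kn.
  have lim := @lin_comb_cvg R X x n b a aP.
  have bound_lim : harmonic k + K * (harmonic k + harmonic l) +
      `|lin_comb x a n - lin_comb x (b l) n| @[l --> \oo] -->
      harmonic k + K * (harmonic k + 0) + `|lin_comb x a n - lin_comb x a n|.
    apply: cvgD.
      apply: cvgD; first exact: cvg_cst.
      by apply: cvgMr; apply: cvgD => //; exact: cvg_cst.
    by apply: cvg_norm; apply: cvgB => //; exact: cvg_cst.
  rewrite subrr normr0 !addr0 in bound_lim.
  rewrite mulrDl mul1r [leRHS]addrC; apply: (cvgr_to_ge bound_lim); near=> l.
  have ln : ((bN k).2 <= maxn n (bN l).2)%N by rewrite leq_max kn.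
  have := xK (fun i => b k i - b l i) n _ (leq_maxl n (bN l).2).
  rewrite !lin_combB (bw k n)// (bw k (maxn _ _))//.
  rewrite (bw l (maxn _ _)) ?leq_maxr// => le_w.
  apply: le_trans (ler_distD (lin_comb x (b l) n) _ _) _.
  rewrite lerD//; last by rewrite distrC.
  apply: le_trans (ler_distD (w k) _ _) _; rewrite lerD//.
  by apply: le_trans le_w _; rewrite ler_wpM2l.
have a_cvg : lin_comb x a n @[n --> \oo] --> v.
  apply/cvgrPdist_le => e e0.
  have e2 : 0 < e / (K + 1) by rewrite divr_gt0// ltr_pwDr.
  have [k kP] := harm_small _ e2; exists (bN k).2 => // n /= kn.
  apply: le_trans (wa _ _ kn) _.
  by rewrite -ler_pdivlMl ?ltr_pwDr// mulrC ltW// kP.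
exists a; split; first by rewrite seriesE.
move=> a' a'v; apply/funext => i; apply/eqP; rewrite -subr_eq0 -normr_le0.
have dv : `|lin_comb x a n - lin_comb x a' n| @[n --> \oo] --> (0 : R).
  rewrite -(@normr0 _ X) -(subrr v); apply: cvg_norm; apply: cvgB => //.
  by rewrite -seriesE.
have dv' : D * `|lin_comb x a n - lin_comb x a' n| @[n --> \oo] --> D * 0.
  exact: cvgMr.
rewrite mulr0 in dv'; apply: (cvgr_to_ge dv').
exists i.+1 => // n /= iN; rewrite -lin_combB.
exact: (xD (fun i => a i - a' i)).
Unshelve. all: by end_near. Qed.

End BasicCriterion.

Section WideS.
Context {R : realType}.

Lemma coefficient_bound (X : normedModType R) (v : nat -> X) (S : R) :
  (forall a m N, (m <= N)%N ->
     `|\sum_(m <= i < N) a i| <= S * `|lin_comb v a N|) ->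
  forall a i N, (i < N)%N -> `|a i| <= 2 * S * `|lin_comb v a N|.
Proof.
move=> vS a i N iN; have := vS a _ _ (ltnW iN); rewrite big_ltn//.
have := vS a _ _ iN; set A := \sum_(i.+1 <= j < N) a j.
move=> A1 A2; have := ler_normB (a i + A) A; rewrite addrK -mulrA; lra.
Qed.

Lemma wide_s_criterion (X : completeNormedModType R) (u : nat -> X)
    (M S K : R) :
  0 < S -> 0 <= K -> (forall n, `|u n| <= M) ->
  (forall a m N, (m <= N)%N ->
     `|\sum_(m <= i < N) a i| <= S * `|lin_comb u a N|) ->
  (forall a m N, (m <= N)%N -> `|lin_comb u a m| <= K * `|lin_comb u a N|) ->
  wide_s u.
Proof.
move=> S0 K0 uM uS uK.
have uD := coefficient_bound uS.
have D0 : 0 < 2 * S by rewrite mulr_gt0.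
split.
- split; last by exists M => _ [n _ <-].
  apply: (@lt_le_trans _ _ (2 * S)^-1); first by rewrite invr_gt0.
  apply: lb_le_inf; first by exists `|u 0%N|, 0%N.
  move=> _ [n _ <-]; have := uD (fun i => (i == n)%:R) n n.+1 (ltnSn n).
  by rewrite eqxx normr1 lin_comb_delta -ler_pdivrMl// mulr1.
- exact: basic_sequence_criterion K0 (ltW D0) uK uD.
- exists S => // a N; apply: sup_norm_summing_le => m; exact: uS.
Qed.

End WideS.

(** * Shift equivalence of convex blocks *)

Section ConvexBlocks.
Context {R : realType} {X : normedModType R}.
Implicit Types x z v : nat -> X.

Lemma blocks_lt (F : nat -> {fset nat}) : (forall n, F n != fset0) ->
  (forall n i j, i \in F n -> j \in F n.+1 -> (i < j)%N) ->
  forall n m i j, (n < m)%N -> i \in F n -> j \in F m -> (i < j)%N.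
Proof.
move=> F0 Flt n m i j nm Fi; rewrite -(subnKC nm) addSn -addnS.
elim: (m - n.+1)%N j => [|d IH] j; first by rewrite addn1; exact: Flt.
have /fset0Pn[k Fk] := F0 (n + d.+1)%N; rewrite addnS => Fj.
exact: ltn_trans (IH k Fk) (Flt _ _ _ Fk Fj).
Qed.

Lemma blocks_ge (F : nat -> {fset nat}) : (forall n, F n != fset0) ->
  (forall n i j, i \in F n -> j \in F n.+1 -> (i < j)%N) ->
  forall n i, i \in F n -> (n <= i)%N.
Proof.
move=> F0 Flt; elim=> [//|n IH] i Fi; have /fset0Pn[k Fk] := F0 n.
exact: leq_ltn_trans (IH k Fk) (Flt _ _ _ Fk Fi).
Qed.

Lemma convex_block_sub x (y : nat -> X) (g : nat -> nat) :
  (forall k, (g k < g k.+1)%N) ->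
  convex_block_of x y -> convex_block_of x (y \o g).
Proof.
move=> gS [F [la [F0 Flt la01 la1 yE]]].
exists (F \o g), (la \o g); split=> //=.
- by move=> n i j; apply: (blocks_lt F0 Flt).
- by move=> n i; exact: la01.
Qed.

(** The n-th block only involves terms of index at least n. *)
Lemma convex_block_dual_cvg z (y : nat -> X) (f : dual X) (p : R) :
  convex_block_of z y ->
  f (z n) @[n --> \oo] --> p -> f (y n) @[n --> \oo] --> p.
Proof.
move=> [F [la [F0 Flt la01 la1 yE]]] /cvgrPdist_le zp.
apply/cvgrPdist_le => e e0.
have [N _ NP] := zp _ e0; exists N => // n /= Nn.
have -> : p - f (y n) = \sum_(i <- F n) la n i * (p - f (z i)).
  under eq_bigr do rewrite mulrBr; rewrite sumrB -mulr_suml la1 mul1r yE.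
  congr (_ - _); rewrite /dual_eval linear_sum; apply: eq_bigr => i _.
  by rewrite linearZ.
apply: le_trans (ler_norm_sum _ _ _) _.
rewrite -[leRHS]mul1r -(la1 n) mulr_suml big_seq [leRHS]big_seq.
apply: ler_sum => i Fi; have /andP[la0 _] := la01 _ _ Fi.
rewrite normrM ger0_norm// ler_wpM2l//; apply: NP => /=.
exact: leq_trans Nn (blocks_ge F0 Flt Fi).
Qed.

Definition delay v m q n := v (if (n < m)%N then n else (n + q)%N).

(** A sequence and the same sequence with its terms from m on moved q places to
    the right have a common shift. *)
Lemma delay_bound z v (L : R) :
  0 < L ->
  (forall y, convex_block_of z y -> uniformly_L_shift_equivalent L y) ->
  convex_block_of z v -> forall a N m q,
  `|lin_comb (delay v m q) a N| <= L ^+ 2 * `|lin_comb v a N|.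
Proof.
move=> L0 zL zv a N m q.
have zd : convex_block_of z (delay v m q).
  pose g n := if (n < m)%N then n else (n + q)%N.
  apply: (convex_block_sub (g := g)) zv => k; rewrite /g.
  case: (ltnP k m) => km; case: (ltnP k.+1 m) => km' //.
  - by rewrite (leq_trans _ (leq_addr _ _)).
  - by move: km; rewrite leqNgt (ltn_trans _ km').
have [_ le1] := zL _ zd m a N.
have [le2 _] := zL _ zv (m + q)%N a N.
have shiftE : (fun n => delay v m q (n + m)%N) = (fun n => v (n + (m + q))%N).
  by apply/funext => n; rewrite /delay ltnNge leq_addl addnA.
rewrite shiftE in le1; apply: le_trans le1 _.
by rewrite expr2 -mulrA ler_wpM2l ?(ltW L0)// -ler_pdivrMl.
Qed.

Lemma dual_delay v m q a N (f : dual X) : (m <= N)%N ->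
  f (lin_comb (delay v m q) a N) =
  f (lin_comb v a m) + \sum_(m <= i < N) a i * f (v (i + q)%N).
Proof.
move=> mN; rewrite !dual_lin_comb.
rewrite -!(big_mkord xpredT (fun i => a i * f (_ i))) (@big_cat_nat _ _ _ m)//=.
congr (_ + _); apply: eq_big_nat => i /andP[mi iN].
  by rewrite /delay iN.
by rewrite /delay ltnNge mi.
Qed.

Section TailBounds.
Context (v : nat -> X) (phi : dual X -> R) (e C B : R).
Context (vphi : forall f : dual X, f (v n) @[n --> \oo] --> phi f).
Context (e0 : 0 < e)
  (gap : forall y : X, exists2 f : dual X, dual_ball f & e < phi f - f y).
Context (vC : forall a N m q,
  `|lin_comb (delay v m q) a N| <= C * `|lin_comb v a N|).
Context (vB : forall n, `|v n| <= B).

Lemma delay_limit a m N (f : dual X) : dual_ball f -> (m <= N)%N ->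
  `|f (lin_comb v a m) + (\sum_(m <= i < N) a i) * phi f| <=
    C * `|lin_comb v a N|.
Proof.
move=> fB mN.
have lim : `|f (lin_comb (delay v m q) a N)| @[q --> \oo] -->
    `|f (lin_comb v a m) + (\sum_(m <= i < N) a i) * phi f|.
  apply: cvg_norm.
  rewrite (_ : (fun q => _) = fun q =>
    f (lin_comb v a m) + \sum_(m <= i < N) a i * f (v (i + q)%N)); last first.
    by apply/funext => q; exact: dual_delay.
  apply: cvgD; first exact: cvg_cst.
  rewrite mulr_suml; elim: (index_iota m N) => [|i s IH].
    rewrite big_nil (_ : (fun q => _) = fun=> 0); first exact: cvg_cst.
    by apply/funext => q; rewrite big_nil.
  rewrite big_cons (_ : (fun q => _) = fun q => a i * f (v (i + q)%N) +
    \sum_(j <- s) a j * f (v (j + q)%N)); last first.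
    by apply/funext => q; rewrite big_cons.
  apply: cvgD => //; apply: cvgMr.
  rewrite (_ : (fun q => _) = fun q => (f \o v) (q + i)%N); last first.
    by apply/funext => q; rewrite addnC.
  by rewrite (cvg_shiftn i (f \o v)); exact: vphi.
apply: (cvgr_to_le lim); near=> q.
by apply: le_trans (dual_ball_norm fB _) (vC _ _ _ _).
Unshelve. all: by end_near. Qed.

(** The bidual element sum_(i < m) a_i v_i + (sum_(m <= i < N) a_i) phi, limit
    of the delayed combinations, has norm at least e |sum_(m <= i < N) a_i|,
    since phi is at distance at least e from X. *)
Lemma tail_sum_bound a m N : (m <= N)%N ->
  `|\sum_(m <= i < N) a i| <= C / e * `|lin_comb v a N|.
Proof.
move=> mN; set A := \sum_(m <= i < N) a i.
rewrite mulrAC ler_pdivlMr//.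
have [A0|A0] := eqVneq A 0.
  by rewrite A0 normr0 mul0r; exact: le_trans (vC a N 0 0).
have [f fB fe] := gap (- A^-1 *: lin_comb v a m).
apply: le_trans (delay_limit a fB mN).
have -> : f (lin_comb v a m) + A * phi f =
    A * (phi f - f (- A^-1 *: lin_comb v a m)).
  by rewrite dualZ mulrBr mulNr mulrN opprK mulrA divff// mul1r addrC.
rewrite normrM ler_wpM2l//; exact: le_trans (ltW fe) (ler_norm _).
Qed.

Lemma partial_sum_bound a m N : (m <= N)%N ->
  `|lin_comb v a m| <= (C + C / e * B) * `|lin_comb v a N|.
Proof.
move=> mN; have [f fB nf] := norming_functional (lin_comb v a m).
apply: le_trans nf _; rewrite mulrDl.
have phiB : `|phi f| <= B.
  have lim : `|f (v n)| @[n --> \oo] --> `|phi f| by exact: cvg_norm.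
  apply: (cvgr_to_le lim); near=> n.
  exact: le_trans (dual_ball_norm fB _) (vB n).
have := delay_limit a fB mN; have := tail_sum_bound a mN.
set A := \sum_(m <= i < N) a i => Ale /ler_normlP[_ Dle].
have : `|A * phi f| <= C / e * `|lin_comb v a N| * B by rewrite normrM ler_pM.
move=> /ler_normlP[+ _]; rewrite [_ * B]mulrAC; lra.
Unshelve. all: by end_near. Qed.

End TailBounds.

End ConvexBlocks.

(** * Convex blocks of weakly null sequences *)

Section MazurBlocks.
Context {R : realType} {X : normedModType R}.
Implicit Types z u v : nat -> X.

Lemma convex_combination (C : set X) (I : eqType) (s : seq I) (la : I -> R)
    (x : I -> X) : convex_subset C ->
  {in s, forall i, 0 <= la i} -> {in s, forall i, C (x i)} ->
  \sum_(i <- s) la i = 1 -> C (\sum_(i <- s) la i *: x i).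
Proof.
move=> Cc la0 xC la1.
have [c0 Cc0] : C !=set0.
  case: s la1 {la0} xC => [|i s _ xC]; last first.
    by exists (x i); apply: xC; rewrite mem_head.
  by rewrite big_nil => /esym/eqP; rewrite oner_eq0.
suff [y Cy yE] : exists2 y, C y &
    \sum_(i <- s) la i *: x i = (\sum_(i <- s) la i) *: y.
  by rewrite yE la1 scale1r.
elim: s la0 xC {la1} => [|i s IH] la0 xC.
  by exists c0; rewrite // !big_nil scale0r.
have [||y Cy yE] := IH.
- by move=> j js; apply: la0; rewrite inE js orbT.
- by move=> j js; apply: xC; rewrite inE js orbT.
have [||||y' Cy' y'E] :=
  @convex_cone _ _ C (la i) (\sum_(j <- s) la j) (x i) y Cc.
- by apply: la0; rewrite mem_head.
- by rewrite big_seq sumr_ge0// => j js; apply: la0; rewrite inE js orbT.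
- by apply: xC; rewrite mem_head.
- by [].
by exists y'; rewrite // !big_cons yE y'E.
Qed.

(** Mazur's lemma: otherwise some functional separates the convex hull of a tail
    of z from the origin. *)
Lemma mazur_tail z m (e : R) : weakly_null z -> 0 < e ->
  exists N (la : nat -> R), [/\ (m < N)%N, forall i, 0 <= la i <= 1,
    \sum_(m <= i < N) la i = 1 & `|\sum_(m <= i < N) la i *: z i| < e].
Proof.
move=> /weakly_convergesP z0 e0; apply: contrapT => far.
pose K := [set k | exists N (la : nat -> R),
  [/\ (m < N)%N, forall i, 0 <= la i <= 1,
    \sum_(m <= i < N) la i = 1 & k = \sum_(m <= i < N) la i *: z i]].
have tail i : (m <= i)%N -> K (z i).
  move=> mi; exists i.+1, (fun j => (j == i)%:R); split=> //.
  - by move=> j; case: eqP; rewrite ?lexx ?ler01.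
  - rewrite big_nat_recr//= eqxx big_nat_cond big1 ?add0r// => j.
    by rewrite andbT => /andP[_ ji]; rewrite ltn_eqF.
  - rewrite big_nat_recr//= eqxx scale1r big_nat_cond big1 ?add0r// => j.
    by rewrite andbT => /andP[_ ji]; rewrite ltn_eqF// scale0r.
have [|t k1 k2 t0 t1|k|f fB fK] := @convex_separation _ X K e.
- by exists (z m); apply: tail.
- move=> [N [la [mN la01 la1 ->]]] [N' [la' [mN' la01' la1' ->]]].
  pose NN := maxn N N'.
  pose mu i := t * truncate la N i + (1 - t) * truncate la' N' i.
  have tr01 (b : nat -> R) M i : (forall i, 0 <= b i <= 1) ->
      0 <= truncate b M i <= 1.
    by move=> b01; rewrite /truncate; case: ifP; rewrite ?b01// lexx ler01.
  have muE (V : lmodType R) (y : nat -> V) : \sum_(m <= i < NN) mu i *: y i =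
      t *: \sum_(m <= i < N) la i *: y i +
      (1 - t) *: \sum_(m <= i < N') la' i *: y i.
    rewrite -(@big_nat_truncate _ _ la _ m N NN) ?leq_maxl ?(ltnW mN)//.
    rewrite -(@big_nat_truncate _ _ la' _ m N' NN) ?leq_maxr ?(ltnW mN')//.
    rewrite !scaler_sumr -big_split; apply: eq_bigr => i _.
    by rewrite /mu scalerDl !scalerA.
  exists NN, mu; split=> [|i||]; last first.
  + by rewrite muE.
  + (* the total weight is the combination of the constant sequence 1 *)
    have := muE R^o (fun=> 1).
    have scale1 (b : nat -> R) n :
        \sum_(m <= i < n) b i *: (1 : R^o) = \sum_(m <= i < n) b i.
      by apply: eq_bigr => i _; exact: mulr1.
    rewrite !scale1 la1 la1' => ->.
    by rewrite /GRing.scale/= !mulr1 addrC subrK.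
  + have /andP[a0 a1] := tr01 la N i la01.
    have /andP[b0 b1] := tr01 la' N' i la01'.
    rewrite /mu; apply/andP; split.
      by rewrite addr_ge0 ?mulr_ge0 ?subr_ge0.
    have : t * truncate la N i <= t by rewrite ler_piMr.
    have : (1 - t) * truncate la' N' i <= 1 - t by rewrite ler_piMr ?subr_ge0.
    by lra.
  + by rewrite leq_max mN.
- move=> [N [la [mN la01 la1 ->]]]; rewrite leNgt; apply/negP => lt_e.
  by apply: far; exists N, la.
- have /cvgrPdist_lt/(_ _ e0)[N _ NP] := z0 f.
  have := NP (maxn N m) (leq_maxl _ _).
  rewrite /= dual0 sub0r normrN => /ltr_normlW; rewrite ltNge => /negP; apply.
  by apply: fK; apply: tail; exact: leq_maxr.
Qed.

(** The blocks are consecutive intervals of indices, some of whose coefficients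
    may vanish. *)
Lemma null_blocks z (e : nat -> R) : weakly_null z -> (forall n, 0 < e n) ->
  exists (F : nat -> {fset nat}) (la : nat -> nat -> R),
    [/\ forall n, F n != fset0,
        forall n i j, i \in F n -> j \in F n.+1 -> (i < j)%N,
        forall n i, i \in F n -> 0 <= la n i <= 1,
        forall n, \sum_(i <- F n) la n i = 1 &
        forall n, `|\sum_(i <- F n) la n i *: z i| < e n].
Proof.
move=> z0 e0.
have /choice[c cP] (nm : nat * nat) : exists Nla : nat * (nat -> R),
    [/\ (nm.2 < Nla.1)%N, forall i, 0 <= Nla.2 i <= 1,
      \sum_(nm.2 <= i < Nla.1) Nla.2 i = 1 &
      `|\sum_(nm.2 <= i < Nla.1) Nla.2 i *: z i| < e nm.1].
  by have [N [la P]] := mazur_tail nm.2 z0 (e0 nm.1); exists (N, la).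
pose b := fix b n := if n is m.+1 then (c (m, b m)).1 else 0%N.
pose F n := [fset j in index_iota (b n) (b n.+1)]%fset.
have Fmem n i : (i \in F n) = (b n <= i < b n.+1)%N.
  by rewrite !inE mem_index_iota.
have Fsum (V : nmodType) n (g : nat -> V) :
    \sum_(i <- F n) g i = \sum_(b n <= i < b n.+1) g i.
  apply: perm_big; apply: uniq_perm; [exact: fset_uniq|exact: iota_uniq|].
  by move=> i; rewrite Fmem mem_index_iota.
have bS n : (b n < b n.+1)%N by have [] := cP (n, b n).
exists F, (fun n => (c (n, b n)).2); split=> n.
- by apply/fset0Pn; exists (b n); rewrite Fmem leqnn bS.
- move=> i j; rewrite !Fmem => /andP[_ ib] /andP[bj _].
  exact: leq_trans ib bj.
- by move=> i _; have [] := cP (n, b n).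
- by rewrite Fsum; have [] := cP (n, b n).
- by rewrite Fsum; have [] := cP (n, b n).
Qed.

End MazurBlocks.

(** * Small perturbations *)

Section Perturbation.
Context {R : realType} {X : normedModType R}.
Implicit Types u v : nat -> X.

Lemma sum_half_powers N : \sum_(i < N) (2^-1 : R) ^+ i.+1 <= 1.
Proof.
suff -> : \sum_(i < N) (2^-1 : R) ^+ i.+1 = 1 - 2^-1 ^+ N.
  by rewrite gerBl exprn_ge0// invr_ge0.
elim: N => [|N IH]; first by rewrite big_ord0 expr0 subrr.
by rewrite big_ord_recr /= IH exprS; lra.
Qed.

(** The i-th coefficient of a combination of v is at most D times its norm, and
    the factors 2 ^- (n + 1) have sum at most 1: replacing v by u moves the
    combination by at most half its norm. *)
Lemma small_perturbation u v (D : R) : 0 < D ->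
  (forall a i N, (i < N)%N -> `|a i| <= D * `|lin_comb v a N|) ->
  (forall n, `|u n - v n| <= (2 * D)^-1 * 2^-1 ^+ n.+1) ->
  L_equivalent_for Num.norm Num.norm 2 u v.
Proof.
move=> D0 vD uv a N.
have : `|lin_comb u a N - lin_comb v a N| <= 2^-1 * `|lin_comb v a N|.
  rewrite /lin_comb -sumrB; apply: le_trans (ler_norm_sum _ _ _) _.
  have termE (i : 'I_N) : `|a i *: u i - a i *: v i| <=
      2^-1 * `|lin_comb v a N| * 2^-1 ^+ i.+1.
    rewrite -scalerBr normrZ.
    apply: le_trans (ler_pM _ _ (vD a i N (ltn_ord i)) (uv i)) _ => //.
    rewrite mulrA ler_wpM2r ?exprn_ge0 ?invr_ge0// le_eqVlt.
    by apply/orP; left; apply/eqP; field; rewrite gt_eqF.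
  apply: le_trans (ler_sum _ (fun i _ => termE i)) _.
  rewrite -mulr_sumr ler_piMr ?mulr_ge0 ?invr_ge0//.
  exact: sum_half_powers.
have := lerB_dist (lin_comb u a N) (lin_comb v a N).
have := lerB_dist (lin_comb v a N) (lin_comb u a N); rewrite distrC.
have := normr_ge0 (lin_comb v a N).
by move=> ? ? ? ?; split; lra.
Qed.

(** A combination of a shift of u is a combination of u itself, so that the
    equivalence of u and v applies to shifts. *)
Lemma shift_equivalent_transfer u v (K L : R) : 0 < K -> 0 < L ->
  L_equivalent_for Num.norm Num.norm K u v ->
  uniformly_L_shift_equivalent L v -> uniformly_shift_equivalent u.
Proof.
move=> K0 L0 uv vL.
have le_u a N : `|lin_comb u a N| <= K * `|lin_comb v a N|.
  by have [+ _] := uv a N; rewrite ler_pdivrMl.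
have le_v a N : `|lin_comb v a N| <= K * `|lin_comb u a N| := (uv a N).2.
pose M := Num.max 1 (K * L * K).
have M1 : 1 <= M by rewrite le_max lexx.
have M0 : 0 < M by exact: lt_le_trans M1.
have chain (s s' t t' : R) : 0 <= s -> s' <= K * t' -> t' <= L * t ->
    t <= K * s -> s' <= M * s.
  move=> s0 s't' t't ts; apply: (@le_trans _ _ (K * L * K * s)).
    apply: le_trans s't' _; rewrite -!mulrA ler_pM2l//.
    by apply: le_trans t't _; rewrite ler_pM2l.
  by rewrite ler_wpM2r// le_max lexx orbT.
exists M => // p a N; have [le1 le2] := vL p a N.
rewrite ler_pdivrMl// in le1; rewrite ler_pdivrMl//.
have us := lin_comb_shift u a N p; have vs := lin_comb_shift v a N p.
rewrite us; rewrite vs in le1 le2.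
by split; [apply: chain le1 _|apply: chain le2 _].
Qed.

End Perturbation.

(** * Convex sets in spaces with property (su) *)

(** Convex blocks of x, and not x itself, meet the requirements: they can be
    taken close in norm to blocks of w, whereas x - w is only weakly null. *)
Lemma wide_s_of_su (R : realType) (X : completeNormedModType R) (C : set X)
    (x : nat -> X) (M : R) : property_su X -> convex_subset C ->
  (forall y, C y -> `|y| <= M) -> (forall n, C (x n)) ->
  nontrivial_weak_cauchy x ->
  exists u : nat -> X,
    (forall n, C (u n)) /\ uniformly_shift_equivalent u /\ wide_s u.
Proof.
move=> su Cc CM Cx ntx; have [xc xnc] := ntx.
have /choice[phi phiP] (f : dual X) :
    exists p : R, f (x n) @[n --> \oo] --> p.
  have /cvg_ex[/= p xp] : cvg (f (x n) @[n --> \oo]).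
    by apply: cauchy_cvg; exact: xc.
  by exists p.
have [[y xy]|[e e0 gap]] := @weak_limit_gap _ X (x @ \oo) phi _ phiP.
  by exfalso; apply: xnc; exists y.
have [w [[_ [L [psi [L0 psi_inc wL]]]] /weakly_convergesP wx]] := su x ntx.
have psi_ge n : (n <= psi n)%N.
  apply: strictly_increasing_ge => k; have := psi_inc k.+1 k.
  by rewrite !leEnat ltnn ltnNge => ->.
pose z i := x (psi i) - w (psi i).
have z0 : weakly_null z.
  apply/weakly_convergesP => f.
  exact: (cvg_comp _ _ (cvg_ge_id psi_ge) (wx f)).
have wphi (f : dual X) : f ((w \o psi) n) @[n --> \oo] --> phi f.
  have lim : f (x n) - f (x n - w n) @[n --> \oo] --> phi f - f 0.
    by apply: cvgB; [exact: phiP|exact: wx].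
  rewrite dual0 subr0 in lim.
  rewrite (_ : (fun n => _) = (fun n => f (x n) - f (x n - w n)) \o psi).
    exact: (cvg_comp _ _ (cvg_ge_id psi_ge) lim).
  by apply/funext => n /=; rewrite dualB opprB addrC subrK.
(* S and D will bound the tail sums and the coefficients of combinations of v,
   in terms of the norm; they depend on L and on the gap e only. *)
pose S := L ^+ 2 / e; have S0 : 0 < S by rewrite divr_gt0 ?exprn_gt0.
pose D := 2 * S; have D0 : 0 < D by rewrite mulr_gt0.
pose eps n : R := (2 * D)^-1 * 2^-1 ^+ n.+1.
have eps0 n : 0 < eps n.
  by rewrite mulr_gt0 ?invr_gt0 ?mulr_gt0 ?exprn_gt0 ?invr_gt0.
have [F [la [F0 Flt la01 la1 laz]]] := null_blocks z0 eps0.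
pose u n := \sum_(i <- F n) la n i *: x (psi i).
pose v n := \sum_(i <- F n) la n i *: w (psi i).
have vblock : convex_block_of (w \o psi) v by exists F, la.
have uv n : `|u n - v n| <= eps n.
  rewrite -sumrB; under eq_bigr do rewrite -scalerBr.
  exact: ltW (laz n).
have uC n : C (u n).
  by apply: convex_combination => // i Fi; have /andP[] := la01 _ _ Fi.
have uM n : `|u n| <= M by exact: CM.
have vB n : `|v n| <= M + (2 * D)^-1.
  have := lerB_dist (v n) (u n); rewrite distrC; have := uM n; have := uv n.
  have : eps n <= (2 * D)^-1.
    apply: ler_piMr; first by rewrite invr_ge0 mulr_ge0// ltW.
    by apply: exprn_ile1; lra.
  lra.
have vphi (f : dual X) : f (v n) @[n --> \oo] --> phi f.
  exact: convex_block_dual_cvg vblock (wphi f).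
have vdelay := delay_bound L0 wL vblock.
have vS := @tail_sum_bound R X v phi e (L ^+ 2) vphi e0 gap vdelay.
have vK := @partial_sum_bound R X v phi e (L ^+ 2) _ vphi e0 gap vdelay vB.
set K := (_ + _) in vK.
have vD := coefficient_bound vS.
have equiv_uv := small_perturbation D0 vD uv.
have le_u a N : `|lin_comb u a N| <= 2 * `|lin_comb v a N|.
  by have [+ _] := equiv_uv a N; rewrite ler_pdivrMl.
have le_v a N : `|lin_comb v a N| <= 2 * `|lin_comb u a N| := (equiv_uv a N).2.
have M0 : 0 <= M by exact: le_trans (uM 0%N).
have K0 : 0 <= K.
  rewrite addr_ge0 ?exprn_ge0 ?(ltW L0)// mulr_ge0 ?(ltW S0)// addr_ge0//.
  by rewrite invr_ge0 mulr_ge0// ltW.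
exists u; split=> //; split.
  exact: shift_equivalent_transfer (ltr0n _ 2) L0 equiv_uv (wL _ vblock).
apply: (@wide_s_criterion _ _ u M (2 * S) (4 * K)) => //.
- by rewrite mulr_ge0.
- move=> a m N mN; apply: le_trans (vS a m N mN) _.
  by apply: le_trans (ler_wpM2l (ltW S0) (le_v a N)) _; rewrite mulrCA mulrA.
- move=> a m N mN; apply: le_trans (le_u a m) _.
  have le_vK := vK a m N mN.
  have le_uK : K * `|lin_comb v a N| <= K * (2 * `|lin_comb u a N|).
    by rewrite ler_wpM2l.
  lra.
Qed.

Theorem lemma7p9 (R : realType) (X : completeNormedModType R)
    (su : property_su X) (C : set X) (hC : bounded_closed_convex C) :
  weakly_compact C \/
  (exists x : nat -> X, (forall n, C (x n)) /\ l1_sequence x) \/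
  (exists x : nat -> X,
     (forall n, C (x n)) /\ uniformly_shift_equivalent x /\ wide_s x).
Proof.
have [_ Cb Ccl /convex_set_subset Cc] := hC.
have [|nCcomp] := pselect (weakly_compact C); [by left|right].
have [M M0 CM] : exists2 M : R, 0 < M & forall y, C y -> `|y| <= M.
  by have /pinfty_ex_gt0[M M0 CM] := Cb; exists M.
have [a [aC a_nwc]] := eberlein_smulian Cb Ccl Cc nCcomp.
have [n nS [xc|xl1]] := rosenthal_l1 (fun k => CM _ (aC k)).
  right; apply: (wide_s_of_su (x := a \o n) su Cc CM) => [k|].
    exact: aC.
  split=> // -[l]; apply: a_nwc; exact: strictly_increasing_ge.
by left; exists (a \o n); split=> // k; exact: aC.
Qed.
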